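(* Let $X$ be a normed linear space, $Y$ a Banach space, and $k\in\mathbb N\cup\{\infty\}$ such that the pair $(X,Y)$ has properties (LE) and (LA$_k$). Let $\Omega\subset X$ be an open set and let $A\subset\Omega$ be relatively closed (in $\Omega$). Suppose that $f\colon A\to Y$ satisfies condition (W) with $G\colon A\to\mathcal L(X;Y)$. Then $f$ can be extended to a mapping $g\in C^1(\Omega;Y)$ such that $Dg=G$ on $A$ and $g$ is $C^k$-smooth on $\Omega\setminus A$.
   Context: All normed linear spaces are real. $U(x,r)$ is the open ball with centre $x$ and radius $r$, $U_X$ is the open unit ball of $X$. An $L$-Lipschitz mapping is a mapping with a (not necessarily minimal) Lipschitz constant $L$. $\mathcal L(X;Y)$ is the normed space of continuous linear operators from $X$ to $Y$. $Dg$ is the Fréchet derivative. For open $\Omega\subset X$, $C^k(\Omega;Y)$ is the space of $C^k$-smooth (in the Fréchet sense) mappings from $\Omega$ to $Y$. Condition (W): a mapping $f\colon A\to Y$, $A\subset X$, satisfies condition (W) with $G$ if $G\colon A\to\mathcal L(X;Y)$ is continuous and for each $x\in A$ the operator $G(x)$ is a strict derivative of $f$ at $x$ with respect to $A$, i.e. for each $\varepsilon>0$ there is $\delta>0$ such that $\|f(z)-f(y)-G(x)[z-y]\|\le\varepsilon\|z-y\|$ whenever $y,z\in U(x,\delta)\cap A$. Property (LE): the pair $(X,Y)$ of normed linear spaces has property (LE) if there is $C>0$ such that for every $A\subset X$ every $L$-Lipschitz mapping $f\colon A\to Y$ has a $CL$-Lipschitz extension to the whole of $X$. Property (LA$_k$),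 $k\in\mathbb N\cup\{\infty\}$: the pair $(X,Y)$ of normed linear spaces has property (LA$_k$) if there is $C\ge0$ such that for any $L$-Lipschitz mapping $f\colon U_X\to Y$ and any $\varepsilon>0$ there is a $CL$-Lipschitz mapping $g\in C^k(U_X;Y)$ such that $\sup_{U_X}\|f-g\|\le\varepsilon$. *)

(* Defs.v *)
From HB Require Import structures.
From mathcomp Require Import all_boot all_order all_algebra.
From mathcomp Require Import all_classical all_reals all_analysis.

Set Implicit Arguments.
Unset Strict Implicit.
Unset Printing Implicit Defensive.

Import Order.TTheory GRing.Theory Num.Theory.
Import numFieldNormedType.Exports.

Local Open Scope classical_set_scope.
Local Open Scope ring_scope.

Section ContinuousLinear.
Context {R : realType} (X Y : normedModType R).
Implicit Types (f : X -> Y) (r : R).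

Definition clin_pred : {pred X -> Y} :=
  fun f => `[< linear f /\ continuous f >].

Lemma clin_predP f : reflect (linear f /\ continuous f) (f \in clin_pred).
Proof. exact: asboolP. Qed.

Lemma clin_pred_submod : submod_closed clin_pred.
Proof.
split.
  apply/clin_predP; split; last exact: cst_continuous.
  by move=> a u v; rewrite [RHS]addr0 [RHS]scaler0.
move=> a f g /clin_predP[fl fc] /clin_predP[gl gc].
apply/clin_predP; split.
  move=> b u v; rewrite /= !fctE fl gl !scalerDr !scalerA (mulrC b).
  by rewrite addrACA.
move=> x; have := fc x; have := gc x; rewrite /continuous_at => gx fx.
by apply: (cvgD _ gx); apply: cvgZl_tmp.
Qed.

HB.instance Definition _ :=
  GRing.isSubmodClosed.Build R (X -> Y) clin_pred clin_pred_submod.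

(* The space L(X; Y), normed below by the operator norm. *)
Record clin := CLin { clin_fun :> X -> Y; _ : clin_fun \in clin_pred }.

HB.instance Definition _ := [isSub for clin_fun].
HB.instance Definition _ := [Choice of clin by <:].
HB.instance Definition _ := [SubChoice_isSubLmodule of clin by <:].

Implicit Types T S : clin.

Lemma clin_linear T : linear T.
Proof. by case: T => f /= /clin_predP[]. Qed.

Lemma clin_continuous T : continuous T.
Proof. by case: T => f /= /clin_predP[]. Qed.

HB.instance Definition _ T :=
  GRing.isLinear.Build R X Y *:%R (clin_fun T) (clin_linear T).

Lemma clinP T S : T =1 S -> T = S.
Proof. by move=> TS; apply/val_inj/funext. Qed.

Lemma clinD T S x : (T + S) x = T x + S x. Proof. by []. Qed.
Lemma clinZ r T x : (r *: T) x = r *: T x. Proof. by []. Qed.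
Lemma clin0 x : (0 : clin) x = 0. Proof. by []. Qed.

Definition opnorm T : R := sup [set `|T x| | x in [set x : X | `|x| <= 1]].

Lemma opnorm_has_sup T : has_sup [set `|T x| | x in [set x : X | `|x| <= 1]].
Proof.
split; first by exists `|T 0|, 0 => //=; rewrite normr0.
have /linear_boundedP/pinfty_ex_gt0[M M0 TM] : bounded_near T (nbhs (0 : X)).
  by apply: continuous_linear_bounded; exact: clin_continuous.
exists M => _ [x /= x1 <-]; rewrite (le_trans (TM x))//.
by rewrite -[leRHS]mulr1 ler_wpM2l// ltW.
Qed.

Lemma opnorm_ubound T x : `|x| <= 1 -> `|T x| <= opnorm T.
Proof. by move=> x1; apply: (sup_upper_bound (opnorm_has_sup T)); exists x. Qed.

Lemma opnorm_ge0 T : 0 <= opnorm T.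
Proof. by rewrite (le_trans (normr_ge0 (T 0)))// opnorm_ubound// normr0. Qed.

Lemma ler_opnorm T x : `|T x| <= opnorm T * `|x|.
Proof.
have [->|x0] := eqVneq x 0; first by rewrite linear0 !normr0 mulr0.
rewrite -ler_pdivrMr ?normr_gt0//.
have /(opnorm_ubound T) : `|(`|x|^-1 *: x)| <= 1.
  by rewrite normrZ normfV normr_id mulVf ?normr_eq0.
by rewrite linearZ/= normrZ normfV normr_id mulrC.
Qed.

Lemma opnorm_le T r : (forall x, `|x| <= 1 -> `|T x| <= r) -> opnorm T <= r.
Proof.
move=> Tr; apply: ge_sup; first by case: (opnorm_has_sup T).
by move=> _ [x /= x1 <-]; exact: Tr.
Qed.

Lemma opnormD T S : opnorm (T + S) <= opnorm T + opnorm S.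
Proof.
apply: opnorm_le => x x1; rewrite clinD (le_trans (ler_normD _ _))//.
by rewrite lerD// opnorm_ubound.
Qed.

Lemma opnormZ r T : opnorm (r *: T) = `|r| * opnorm T.
Proof.
apply/eqP; rewrite eq_le; apply/andP; split.
  apply: opnorm_le => x x1; rewrite clinZ normrZ ler_wpM2l//.
  exact: opnorm_ubound.
have [->|r0] := eqVneq r 0; first by rewrite normr0 mul0r opnorm_ge0.
rewrite -ler_pdivlMl ?normr_gt0//; apply: opnorm_le => x x1.
by rewrite ler_pdivlMl ?normr_gt0// -normrZ -clinZ opnorm_ubound.
Qed.

Lemma opnorm0_eq0 T : opnorm T = 0 -> T = 0.
Proof.
move=> T0; apply: clinP => x; apply/eqP; rewrite clin0 -normr_le0.
by rewrite (le_trans (ler_opnorm T x))// T0 mul0r.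
Qed.

HB.instance Definition _ :=
  Lmodule_isNormed.Build R clin opnormD opnormZ opnorm0_eq0.

End ContinuousLinear.

Arguments clin_fun {R X Y}.

Section Smooth.
Context {R : realType} {X : normedModType R}.

(* The Fréchet derivative as an element of L(X; Y), with a junk value at the
   points where [f] is not differentiable. *)
Definition fderiv {Y : normedModType R} (f : X -> Y) (x : X) : clin X Y :=
  insubd 0 ('d f x : X -> Y).

Lemma fderivE (Y : normedModType R) (f : X -> Y) (x : X) :
  differentiable f x -> fderiv f x = 'd f x :> (X -> Y).
Proof.
move=> df; rewrite /fderiv.
change (val (insubd (0 : clin X Y) ('d f x : X -> Y)) = 'd f x :> (X -> Y)).
rewrite insubdK//; apply/clin_predP; split; last exact: diff_continuous.
exact: linearP.
Qed.

(* C^n on [O], meant for open [O]: only the restriction of [f] to [O] then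
   matters. The target changes from [Y] to L(X; Y) at each step. *)
Fixpoint Cn_on (O : set X) (n : nat) : forall Y : normedModType R, (X -> Y) -> Prop :=
  match n with
  | 0 => fun Y f => {within O, continuous f}
  | m.+1 => fun Y f =>
      (forall x, O x -> differentiable f x) /\
      @Cn_on O m (clin X Y) (fderiv f)
  end.

(* [None] stands for k = infinity. *)
Definition Ck_on (O : set X) (k : option nat) (Y : normedModType R) (f : X -> Y) :=
  match k with
  | Some n => Cn_on O n f
  | None => forall n, Cn_on O n f
  end.

End Smooth.

Section Properties.
Context {R : realType}.
Implicit Types X Y : normedModType R.

(* Mappings defined on a subset of [X] are total functions of which only the
   values on that subset are used. *)
Definition condW X Y (A : set X) (f : X -> Y) (G : X -> clin X Y) : Prop :=
  {within A, continuous G} /\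
  forall x, A x -> forall e : R, 0 < e -> exists2 d : R, 0 < d &
    forall y z, (ball x d `&` A) y -> (ball x d `&` A) z ->
      `|f z - f y - G x (z - y)| <= e * `|z - y|.

(* A negative L must be excluded: for [A] with at most one point any L
   satisfies the Lipschitz inequality. *)
Definition propLE X Y : Prop :=
  exists2 C : R, 0 < C &
    forall (A : set X) (L : R) (f : X -> Y), 0 <= L -> L.-lipschitz_A f ->
      exists2 g : X -> Y, (C * L).-lipschitz g & {in A, g =1 f}.

Definition unit_ball X : set X := ball 0 1.
Arguments unit_ball : clear implicits.

Definition propLA (k : option nat) X Y : Prop :=
  exists2 C : R, 0 <= C &
    forall (L : R) (f : X -> Y) (e : R),
      0 <= L -> L.-lipschitz_(unit_ball X) f -> 0 < e ->
      exists g : X -> Y,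
        [/\ (C * L).-lipschitz_(unit_ball X) g,
            Ck_on (unit_ball X) k g &
            (ereal_sup [set `|f x - g x|%:E | x in unit_ball X] <= e%:E)%E].

End Properties.

(* Main.v *)
Require Import Defs.
From HB Require Import structures.
From mathcomp Require Import all_boot all_order all_algebra.
From mathcomp Require Import all_classical all_reals all_analysis.
From mathcomp Require Import ring lra.
Set Implicit Arguments.
Unset Strict Implicit.
Unset Printing Implicit Defensive.
Import Order.TTheory GRing.Theory Num.Theory.
Import numFieldNormedType.Exports.
Local Open Scope classical_set_scope.
Local Open Scope ring_scope.

(* First [f] is extended to a map [ft], not yet smooth off [A], having the strict
   derivative [G a] with respect to [Omega] at every [a] in [A].  For each [e],
   gluing (LE)-extensions of the maps [f - G a], restricted to small balls, gives
   [q_e] equal to [f] on [A] and such that [q_e - G a] is [e]-Lipschitz near each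
   [a] in [A]: on the cell of [c] the glued pieces all agree with [f] on [A], so
   the derivatives of the partition functions do no harm close enough to [A].
   With [e_n = 2^-n], [ft = q_0 + sum psi_(n+1) (q_(n+1) - q_n)], where the
   cutoff [psi_n] is [1] near [A], vanishes off a small neighbourhood of [A] and
   is [3 / dist(x, A)]-Lipschitz near [x]; this is harmless since
   [q_(n+1) - q_n] is of order [2^-n dist(x, A)].
   Then [ft] is smoothed off [A]: near [x], (LA_k) is applied to [ft - T_x], where
   [ft - T_x] has an almost minimal local Lipschitz constant, and the pieces are
   glued with errors that beat the Lipschitz constants of the partition functions.
   The partitions of unity are Stone's, made Lipschitz and C^k by applying
   (LE), (LA_k), a norming functional of [Y] and a smooth step. *)

(** The radius on which (W) holds with a given accuracy varies over [A] without a uniform bound, so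
    no cutoff or cell can have a size fixed in advance; depths and distances stand in for sizes. A
    partition of unity does harm only through the Lipschitz constants of its functions times the
    disagreement of the glued pieces, because the differences of the weights sum to [0]; each
    construction keeps that product small. (LA_k) enlarges a Lipschitz constant by a factor [C], so
    the linear part has to be removed before smoothing. Near [a] in [A] the operator [G a] is one
    candidate for T_x; hence the almost minimal constant tends to [0] there and T_x tends to [G a],
    without any choice of a nearby point of [A]. (LE) and (LA_k) concern maps into [Y] only; the
    real bump functions therefore start as maps into [Y] with values [0] and a unit vector, which
    requires a nonzero vector in [Y]. *)

(** * Fréchet derivatives in epsilon-delta form: sums and compositions *)

Section FrechetCalculus.
Context {R : realType}.
Implicit Types X Y Z : normedModType R.

Lemma nbhs_distP X (x : X) (P : set X) :
  nbhs x P <-> exists2 d : R, 0 < d & forall y, `|y - x| < d -> P y.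
Proof.
split => [/nbhs_normP[d /= d0 dP]|[d d0 dP]].
  by exists d => // y yx; apply: dP; rewrite /= distrC.
by apply/nbhs_normP; exists d => //= y /=; rewrite distrC; exact: dP.
Qed.

Lemma ball_distE X (x : X) (r : R) y : ball x r y = (`|y - x| < r) :> Prop.
Proof. by rewrite -ball_normE /= distrC. Qed.

Lemma clin_of_bound X Y (f : X -> Y) (M : R) : linear f ->
  (forall x, `|f x| <= M * `|x|) -> f \in @clin_pred R X Y.
Proof.
move=> fl fM; apply/clin_predP; split=> //.
pose g := GRing.isLinear.Build R X Y *:%R f fl.
pose h : {linear X -> Y} := HB.pack f g.
suff : continuous h by [].
apply: bounded_linear_continuous; apply/linear_boundedP.
near=> r => x; rewrite (le_trans (fM x))// ler_wpM2r//.
Unshelve. all: by end_near. Qed.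

(* Junk value [0] when [f] is not a continuous linear map. *)
Definition clin_of X Y (f : X -> Y) : clin X Y := insubd 0 f.

Lemma clin_ofE X Y (f : X -> Y) (M : R) : linear f ->
  (forall x, `|f x| <= M * `|x|) -> clin_of f = f :> (X -> Y).
Proof.
move=> fl fM; rewrite /clin_of.
change (val (insubd (0 : clin X Y) f) = f).
by rewrite insubdK//; exact: clin_of_bound fM.
Qed.

Lemma clin_norm X Y (T : clin X Y) x : `|T x| <= `|T| * `|x|.
Proof. exact: ler_opnorm. Qed.

Lemma clin_norm_le X Y (T : clin X Y) (M : R) : 0 <= M ->
  (forall x, `|T x| <= M * `|x|) -> `|T| <= M.
Proof.
move=> M0 TM; apply: opnorm_le => x x1; rewrite (le_trans (TM x))//.
by rewrite -[leRHS]mulr1 ler_wpM2l.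
Qed.

(* By homogeneity an operator is controlled by its values near the origin. *)
Lemma clin_norm_near0 X Y (T : clin X Y) (M d : R) : 0 <= M -> 0 < d ->
  (forall x, `|x| < d -> `|T x| <= M * `|x|) -> `|T| <= M.
Proof.
move=> M0 d0 TM; apply: clin_norm_le => // x.
have [->|x0] := eqVneq x 0; first by rewrite linear0 !normr0 mulr0.
have n0 : 0 < `|x| by rewrite normr_gt0.
have [s s0 sx] : exists2 s : R, 0 < s & s * `|x| < d.
  exists (d / 2 / `|x|); first by rewrite !divr_gt0.
  by rewrite divfK ?gt_eqF// ltr_pdivrMr// ltr_pMr// ltr1n.
have := TM (s *: x).
rewrite linearZ /= (normrZ s x) (normrZ s (T x)) (gtr0_norm s0).
by rewrite mulrCA ler_pM2l//; exact.
Qed.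

(** The relation carries existence and value of the derivative at once, which avoids both the junk
    value of [fderiv] and little-o manipulations; [fderP] translates. *)
Definition fder X Y (f : X -> Y) (x : X) (T : clin X Y) : Prop :=
  forall e : R, 0 < e -> exists2 d : R, 0 < d &
    forall y, `|y - x| < d -> `|f y - f x - T (y - x)| <= e * `|y - x|.

Lemma fderP X Y (f : X -> Y) x (T : clin X Y) :
  fder f x T <-> differentiable f x /\ fderiv f x = T.
Proof.
have E (g : {linear X -> Y}) : (f \o shift x = cst (f x) + g +o_ 0 id) <->
  forall e : R, 0 < e -> exists2 d : R, 0 < d &
    forall y, `|y - x| < d -> `|f y - f x - g (y - x)| <= e * `|y - x|.
  split.
    move=> /eqaddoP h e e0; have /nbhs_distP[d d0 hd] := h e e0.
    exists d => // y yx; have := hd (y - x).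
    by rewrite subr0 /= !fctE /= subrK opprD addrA; exact.
  move=> h; apply/eqaddoP => e e0; have [d d0 hd] := h e e0.
  apply/nbhs_distP; exists d => // y; rewrite subr0 => yd.
  by have := hd (y + x); rewrite addrK /= !fctE /= opprD addrA; exact.
split.
  move=> /E/= h; have dT := diff_unique (@clin_continuous _ _ _ T) h.
  have df : differentiable f x.
    apply/diff_locallyP; split; first by rewrite dT; exact: clin_continuous.
    by rewrite dT.
  by split => //; apply: clinP => y; rewrite fderivE// dT.
move=> [df <-]; have /diff_locallyP[_ /E h] := df.
move=> e e0; have [d d0 hd] := h e e0; exists d => // y yd.
by rewrite fderivE//; exact: hd.
Qed.

Lemma fderivP X Y (f : X -> Y) x : differentiable f x -> fder f x (fderiv f x).
Proof. by move=> df; apply/fderP. Qed.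

Lemma fder_eq X Y (f : X -> Y) x T : fder f x T -> fderiv f x = T.
Proof. by move/fderP => []. Qed.

Lemma fder_near X Y (f g : X -> Y) x T : (\forall y \near x, f y = g y) ->
  fder f x T -> fder g x T.
Proof.
move=> /nbhs_distP[d d0 fg] fT e e0; have [d' d'0 h] := fT e e0.
exists (Num.min d d'); first by rewrite lt_min d0.
move=> y; rewrite lt_min => /andP[yd yd'].
by rewrite -!fg ?h// subrr normr0.
Qed.

Lemma fder_lipschitz X Y (f : X -> Y) x T : fder f x T ->
  exists2 d : R, 0 < d &
    forall y, `|y - x| < d -> `|f y - f x| <= (`|T| + 1) * `|y - x|.
Proof.
move=> /(_ 1 ltr01)[d d0 h]; exists d => // y /h{}h.
rewrite -[f y - f x](subrK (T (y - x))) (le_trans (ler_normD _ _))//.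
by rewrite mulrDl addrC lerD// clin_norm.
Qed.

Lemma fder_cst X Y (c : Y) (x : X) : fder (fun=> c) x 0.
Proof.
move=> e e0; exists 1 => // y _.
by rewrite subrr clin0 subr0 normr0 mulr_ge0// ltW.
Qed.

Lemma fder_clin X Y (T : clin X Y) (x : X) : fder T x T.
Proof.
move=> e e0; exists 1 => // y _.
by rewrite linearB /= subrr normr0 mulr_ge0// ltW.
Qed.

Lemma fderD X Y (f g : X -> Y) (x : X) S T :
  fder f x S -> fder g x T -> fder (fun y => f y + g y) x (S + T).
Proof.
move=> fS gT e e0; have e20 : 0 < e / 2 by rewrite divr_gt0.
have [d1 d10 h1] := fS _ e20; have [d2 d20 h2] := gT _ e20.
exists (Num.min d1 d2); first by rewrite lt_min d10.
move=> y; rewrite lt_min => /andP[y1 y2].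
have -> : f y + g y - (f x + g x) - (S + T) (y - x) =
  (f y - f x - S (y - x)) + (g y - g x - T (y - x)).
  by rewrite clinD !opprD (addrACA (f y)) (addrACA (f y - f x)).
rewrite (le_trans (ler_normD _ _))// [e]splitr mulrDl.
by rewrite lerD ?h1 ?h2.
Qed.

Lemma comp_clin_subproof X Y Z (S : clin Y Z) (T : clin X Y) :
  clin_of (S \o T) = S \o T :> (X -> Z).
Proof.
apply: (@clin_ofE _ _ _ (`|S| * `|T|)).
  by move=> a u v; rewrite /= !linearP.
move=> x; rewrite /= (le_trans (clin_norm _ _))// -mulrA ler_wpM2l//.
exact: clin_norm.
Qed.

Definition comp_clin X Y Z (S : clin Y Z) (T : clin X Y) : clin X Z :=
  clin_of (S \o T).

Lemma comp_clinE X Y Z (S : clin Y Z) (T : clin X Y) x :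
  comp_clin S T x = S (T x).
Proof. by rewrite /comp_clin comp_clin_subproof. Qed.

Lemma fder_comp X Y Z (f : X -> Y) (g : Y -> Z) x S T :
  fder f x T -> fder g (f x) S -> fder (g \o f) x (comp_clin S T).
Proof.
move=> fT gS e e0.
have [d1 d10 h1] := fder_lipschitz fT.
pose K := `|T| + 1; have K0 : 0 < K by rewrite ltr_wpDl.
pose M := `|S| + 1; have M0 : 0 < M by rewrite ltr_wpDl.
have e20 : 0 < e / 2 by rewrite divr_gt0.
have [d2 d20 h2] := gS _ (divr_gt0 e20 K0).
have [d3 d30 h3] := fT _ (divr_gt0 e20 M0).
exists (Num.min d1 (Num.min (d2 / K) d3)).
  by rewrite !lt_min d10 d30 divr_gt0.
move=> y; rewrite !lt_min => /and3P[y1 y2 y3].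
rewrite comp_clinE /=.
have -> : g (f y) - g (f x) - S (T (y - x)) =
  (g (f y) - g (f x) - S (f y - f x)) + S (f y - f x - T (y - x)).
  by rewrite [S (f y - f x - _)]linearB /= addrA subrK.
rewrite (le_trans (ler_normD _ _))// [e]splitr mulrDl lerD//.
  have fyx := h1 _ y1.
  rewrite (le_trans (h2 _ _))//.
    by rewrite (le_lt_trans fyx)// mulrC -ltr_pdivlMr.
  by rewrite mulrAC ler_pdivrMr// -[leRHS]mulrA ler_wpM2l ?(ltW e20)// mulrC.
rewrite (le_trans (clin_norm _ _))//.
rewrite (@le_trans _ _ (`|S| * (e / 2 / M * `|y - x|)))//.
  by rewrite ler_wpM2l// h3.
rewrite mulrCA mulrAC ler_pdivrMr// -[leRHS]mulrA ler_wpM2l ?(ltW e20)//.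
by rewrite mulrC ler_wpM2l// lerDl.
Qed.

End FrechetCalculus.

(** * Stability of the C^n classes under localisation, bilinear products and composition *)

Section CnCalculus.
Context {R : realType}.
Implicit Types X Y Z : normedModType R.

Lemma continuous_distP X Y (f : X -> Y) x : {for x, continuous f} <->
  forall e : R, 0 < e -> exists2 d : R, 0 < d &
    forall y, `|y - x| < d -> `|f y - f x| <= e.
Proof.
split.
  move=> /cvgrPdist_le fx e e0; have /nbhs_distP[d d0 h] := fx e e0.
  by exists d => // y /h; rewrite distrC.
move=> h; apply/cvgrPdist_le => e e0; have [d d0 hd] := h e e0.
by apply/nbhs_distP; exists d => // y /hd; rewrite distrC.
Qed.

Lemma fder_continuous X Y (f : X -> Y) x T :
  fder f x T -> {for x, continuous f}.
Proof.
move=> /fderP[df _]; exact: differentiable_continuous.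
Qed.

Lemma Cn_on0P X Y (O : set X) (f : X -> Y) : open O ->
  Cn_on O 0 f <-> forall x, O x -> {for x, continuous f}.
Proof.
move=> oO; rewrite /= continuous_open_subspace//; split.
  by move=> h x Ox; apply: h; rewrite inE.
by move=> h x; rewrite inE; exact: h.
Qed.

(** On an open [V] the map [fderiv f] depends only on the values of [f] on [V], so the induction can
    pass from [f] to [fderiv f]. Glued maps are handled through this lemma, on neighbourhoods where
    they are finite sums. *)
Lemma Cn_on_local X Y (O : set X) n (f : X -> Y) : open O ->
  (forall x, O x -> exists V (g : X -> Y),
    [/\ open V, V x, Cn_on V n g & forall y, V y -> f y = g y]) ->
  Cn_on O n f.
Proof.
move=> oO; elim: n Y f => [|n IH] Y f h.
  apply/Cn_on0P => // x /h[V [g [oV Vx /Cn_on0P gc fg]]].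
  have /continuous_distP {}gc := gc oV x Vx.
  have /nbhs_distP[d d0 dV] : nbhs x V by exact: open_nbhs_nbhs.
  apply/continuous_distP => e /gc[d' d'0 gd'].
  exists (Num.min d d'); first by rewrite lt_min d0.
  by move=> y; rewrite lt_min => /andP[/dV Vy /gd']; rewrite !fg.
have fdE x V (g : X -> Y) : open V -> V x -> differentiable g x ->
    (forall y, V y -> f y = g y) -> fder f x (fderiv g x).
  move=> oV Vx dg fg; apply: fder_near (fderivP dg).
  by near=> y; rewrite fg//; near: y; exact: open_nbhs_nbhs.
split.
  move=> x /h[V [g [oV Vx [dg _] fg]]].
  by have /fderP[] := fdE x V g oV Vx (dg _ Vx) fg.
apply: IH => x /h[V [g [oV Vx [dg Cg] fg]]].
exists V, (fderiv g); split; [exact: oV|exact: Vx|exact: Cg|move=> y Vy].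
exact: fder_eq (fdE y V g oV Vy (dg _ Vy) fg).
Unshelve. all: by end_near. Qed.

Lemma Cn_on_ext X Y (O : set X) n (f g : X -> Y) : open O ->
  (forall x, O x -> f x = g x) -> Cn_on O n f -> Cn_on O n g.
Proof.
by move=> oO fg Cf; apply: Cn_on_local => // x Ox; exists O, f; split=> // y /fg.
Qed.

Lemma Cn_on_sub X Y (O V : set X) n (f : X -> Y) : open O -> open V ->
  V `<=` O -> Cn_on O n f -> Cn_on V n f.
Proof. by move=> oO oV VO Cf; apply: Cn_on_local => // x /VO Ox; exists O, f. Qed.

Lemma Cn_onS X Y (O : set X) n (f : X -> Y) (D : X -> clin X Y) : open O ->
  (forall x, O x -> fder f x (D x)) -> Cn_on O n D -> Cn_on O n.+1 f.
Proof.
move=> oO fD CD; split=> [x /fD/fderP[]//|].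
by apply: Cn_on_ext CD => // x /fD/fder_eq.
Qed.

Lemma Cn_onW X Y (O : set X) n (f : X -> Y) : open O ->
  Cn_on O n.+1 f -> Cn_on O n f.
Proof.
move=> oO; elim: n Y f => [|n IH] Y f [df Cf].
  by apply/Cn_on0P => // x /df; exact: differentiable_continuous.
by split; [exact: df|exact: IH Cf].
Qed.

Lemma Cn_on_cst X Y (O : set X) n (c : Y) : open O -> Cn_on O n (fun=> c).
Proof.
move=> oO; elim: n Y c => [|n IH] Y c.
  by apply/Cn_on0P => // x _; exact: cst_continuous.
apply: (@Cn_onS _ _ _ _ _ (fun=> 0)) => // x _; exact: fder_cst.
Qed.

Lemma Cn_on_clin X Y (O : set X) n (T : clin X Y) : open O -> Cn_on O n T.
Proof.
move=> oO; case: n => [|n].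
  by apply/Cn_on0P => // x _; exact: clin_continuous.
apply: (@Cn_onS _ _ _ _ _ (fun=> T)) => // [x _|]; first exact: fder_clin.
exact: Cn_on_cst.
Qed.

Lemma Cn_onD X Y (O : set X) n (f g : X -> Y) : open O ->
  Cn_on O n f -> Cn_on O n g -> Cn_on O n (fun x => f x + g x).
Proof.
move=> oO; elim: n Y f g => [|n IH] Y f g.
  move=> /Cn_on0P fc /Cn_on0P gc; apply/Cn_on0P => // x Ox.
  by apply: continuousD; [exact: fc|exact: gc].
move=> [df Cf] [dg Cg].
apply: (@Cn_onS _ _ _ _ _ (fun x => fderiv f x + fderiv g x)) => //.
  by move=> x Ox; apply: fderD; apply: fderivP; [exact: df|exact: dg].
exact: (IH (clin X Y) (fderiv f) (fderiv g) Cf Cg).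
Qed.

Lemma Cn_on_sum X Y (O : set X) n (f : nat -> X -> Y) N : open O ->
  (forall i, (i < N)%N -> Cn_on O n (f i)) ->
  Cn_on O n (fun x => \sum_(i < N) f i x).
Proof.
move=> oO; elim: N => [|N IH] Cf.
  apply: (@Cn_on_ext _ _ _ _ (fun=> 0)) => //; last exact: Cn_on_cst.
  by move=> x _; rewrite big_ord0.
apply: (@Cn_on_ext _ _ _ _ (fun x => \sum_(i < N) f i x + f N x)) => //.
  by move=> x _; rewrite big_ord_recr.
by apply: Cn_onD => //; [apply: IH => i iN; apply: Cf; rewrite ltnW|exact: Cf].
Qed.

Definition bounded_bilinear X Y Z (B : X -> Y -> Z) : Prop :=
  [/\ forall u, linear (B u), forall v, linear (B^~ v) &
      exists2 M : R, 0 <= M & forall u v, `|B u v| <= M * `|u| * `|v|].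

Lemma bounded_bilinear_flip X Y Z (B : X -> Y -> Z) :
  bounded_bilinear B -> bounded_bilinear (fun v u => B u v).
Proof.
move=> [Bl Br [M M0 BM]]; split=> //; exists M => // u v.
by rewrite mulrAC; exact: BM.
Qed.

Section Bilinear.
Variables (X Y1 Y2 Z : normedModType R) (B : Y1 -> Y2 -> Z).
Hypothesis bB : bounded_bilinear B.

Let BDl u u' v : B (u + u') v = B u v + B u' v.
Proof. by have [_ /(_ v) l _] := bB; have := l 1 u u'; rewrite !scale1r. Qed.

Let BDr u v v' : B u (v + v') = B u v + B u v'.
Proof. by have [/(_ u) l _ _] := bB; have := l 1 v v'; rewrite !scale1r. Qed.

Let B0l v : B 0 v = 0.
Proof. by apply: (addrI (B 0 v)); rewrite -BDl !addr0. Qed.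

Let B0r u : B u 0 = 0.
Proof. by apply: (addrI (B u 0)); rewrite -BDr !addr0. Qed.

Let BZl a u v : B (a *: u) v = a *: B u v.
Proof. by have [_ /(_ v) l _] := bB; have := l a u 0; rewrite !addr0 B0l addr0. Qed.

Let BZr a u v : B u (a *: v) = a *: B u v.
Proof. by have [/(_ u) l _ _] := bB; have := l a v 0; rewrite !addr0 B0r addr0. Qed.

Let BNl u v : B (- u) v = - B u v.
Proof. by rewrite -scaleN1r BZl scaleN1r. Qed.

Let BNr u v : B u (- v) = - B u v.
Proof. by rewrite -scaleN1r BZr scaleN1r. Qed.

Lemma bilinear_lcompE (S : clin X Y1) v :
  clin_of (fun h => B (S h) v) = (fun h => B (S h) v) :> (X -> Z).
Proof.
have [_ _ [M M0 BM]] := bB.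
apply: (@clin_ofE _ _ _ _ (M * `|S| * `|v|)).
  by move=> a x y; rewrite linearP BDl BZl.
move=> x; rewrite (le_trans (BM _ _))// [leRHS]mulrAC ler_wpM2r//.
by rewrite -[leRHS]mulrA ler_wpM2l// clin_norm.
Qed.

Lemma bilinear_rcompE u (T : clin X Y2) :
  clin_of (fun h => B u (T h)) = (fun h => B u (T h)) :> (X -> Z).
Proof.
have [_ _ [M M0 BM]] := bB.
apply: (@clin_ofE _ _ _ _ (M * `|u| * `|T|)).
  by move=> a x y; rewrite linearP BDr BZr.
move=> x; rewrite (le_trans (BM _ _))// -[leRHS]mulrA ler_wpM2l ?mulr_ge0//.
exact: clin_norm.
Qed.

(** This is the bilinear map that appears on differentiating [B (f x) (g x)] in its first argument;
    the second argument is treated by flipping [B]. *)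
Lemma bounded_bilinear_lcomp :
  bounded_bilinear (fun (S : clin X Y1) v => clin_of (fun h => B (S h) v)).
Proof.
have [_ _ [M M0 BM]] := bB; split.
- move=> S a u v; apply: clinP => h.
  by rewrite clinD clinZ !bilinear_lcompE BDr BZr.
- move=> v a S T; apply: clinP => h.
  by rewrite clinD clinZ !bilinear_lcompE clinD clinZ BDl BZl.
exists M => // S v; apply: clin_norm_le; first by rewrite !mulr_ge0.
move=> h; rewrite bilinear_lcompE (le_trans (BM _ _))//.
by rewrite [leRHS]mulrAC ler_wpM2r// -[leRHS]mulrA ler_wpM2l// clin_norm.
Qed.

Lemma fder_bilinear (f : X -> Y1) (g : X -> Y2) x S T :
  fder f x S -> fder g x T ->
  fder (fun y => B (f y) (g y)) x
    (clin_of (fun h => B (S h) (g x)) + clin_of (fun h => B (f x) (T h))).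
Proof.
move=> fS gT e e0; have [_ _ [M M0 BM]] := bB.
have [d1 d10 h1] := fder_lipschitz fS.
have [d2 d20 h2] := fder_lipschitz gT.
(* [K] collects the factors of three errors: the two first-order remainders and the quadratic term
   [B (f y - f x) (g y - g x)], in which one factor [|h|] is bounded by [e / K]. *)
pose K := M * (`|g x| + `|f x| + (`|S| + 1) * (`|T| + 1)) + 1.
have K0 : 0 < K by rewrite ltr_wpDl// !mulr_ge0// !addr_ge0// mulr_ge0// addr_ge0.
have eK : 0 < e / K by rewrite divr_gt0.
have [d3 d30 h3] := fS _ eK; have [d4 d40 h4] := gT _ eK.
exists (Num.min (Num.min d1 d2) (Num.min (Num.min d3 d4) (e / K))).
  by rewrite !lt_min d10 d20 d30 d40.
move=> y; rewrite !lt_min => /andP[/andP[y1 y2] /andP[/andP[y3 y4] y5]].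
set h := y - x in y1 y2 y3 y4 y5 *.
rewrite clinD bilinear_lcompE bilinear_rcompE.
have -> : B (f y) (g y) - B (f x) (g x) - (B (S h) (g x) + B (f x) (T h)) =
  B (f y - f x - S h) (g x) + B (f x) (g y - g x - T h)
  + B (f y - f x) (g y - g x).
  rewrite -[in B (f y)](subrKC (f x) (f y)) -[in B _ (g y)](subrKC (g x) (g y)).
  move: (f y - f x) (g y - g x) => p q.
  rewrite !(BDl, BDr, BNl, BNr).
  move: (B (f x) (g x)) (B (f x) q) (B p (g x)) (B p q) (B (S h) _) (B _ (T h)).
  move=> a b c d s t; rewrite -(addrA a) (addrAC a) subrr add0r opprD.
  by rewrite (addrACA c) (addrAC (c + b)) (addrC c b) (addrA b).
have N x1 x2 b1 b2 b3 : `|x1| <= b1 -> `|x2| <= b2 -> b1 * b2 <= b3 ->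
    `|B x1 x2| <= M * b3.
  move=> l1 l2 l3; rewrite (le_trans (BM _ _))// -mulrA ler_wpM2l//.
  by rewrite (le_trans _ l3)// ler_pM.
have l1 : `|B (f y - f x - S h) (g x)| <= M * (e / K * `|h| * `|g x|).
  exact: N (h3 _ y3) (lexx _) (lexx _).
have l2 : `|B (f x) (g y - g x - T h)| <= M * (`|f x| * (e / K * `|h|)).
  exact: N (lexx _) (h4 _ y4) (lexx _).
have l3 : `|B (f y - f x) (g y - g x)| <=
    M * ((`|S| + 1) * (`|T| + 1) * (e / K * `|h|)).
  apply: N (h1 _ y1) (h2 _ y2) _.
  by rewrite mulrACA ler_wpM2l ?mulr_ge0 ?addr_ge0// ler_wpM2r// ltW.
rewrite (le_trans (ler_normD _ _))// (le_trans (lerD (ler_normD _ _) l3))//.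
rewrite (le_trans (lerD (lerD l1 l2) (lexx _)))//.
have -> : e * `|h| = K * (e / K * `|h|) by rewrite mulrA mulrCA divff ?mulr1 ?gt_eqF.
have := mulr_ge0 (ltW eK) (normr_ge0 h); move: (e / K * _) => w w0.
by rewrite /K -subr_ge0 (_ : _ - _ = w)//; ring.
Qed.

Lemma continuous_bilinear (f : X -> Y1) (g : X -> Y2) x :
  {for x, continuous f} -> {for x, continuous g} ->
  {for x, continuous (fun y => B (f y) (g y))}.
Proof.
move=> /continuous_distP fc /continuous_distP gc; apply/continuous_distP => e e0.
have [_ _ [M M0 BM]] := bB.
pose K := M * (`|g x| + 1 + `|f x|) + 1.
have K0 : 0 < K by rewrite ltr_wpDl// !mulr_ge0// !addr_ge0.
have eK : 0 < e / K by rewrite divr_gt0.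
have [d1 d10 h1] := fc _ eK; have [d2 d20 h2] := gc _ eK.
have [d3 d30 h3] := gc _ ltr01.
exists (Num.min d1 (Num.min d2 d3)); first by rewrite !lt_min d10 d20.
move=> y; rewrite !lt_min => /and3P[/h1 y1 /h2 y2 /h3 y3].
have -> : B (f y) (g y) - B (f x) (g x) =
    B (f y - f x) (g y) + B (f x) (g y - g x).
  by rewrite BDl BDr BNl BNr addrA subrK.
have gy : `|g y| <= `|g x| + 1.
  by rewrite -[g y](subrKC (g x)) (le_trans (ler_normD _ _)) ?lerD2l.
rewrite (le_trans (ler_normD _ _))// (le_trans (lerD (BM _ _) (BM _ _)))//.
rewrite (@le_trans _ _ (M * (e / K) * (`|g x| + 1) + M * `|f x| * (e / K)))//.
  by rewrite lerD ?ler_pM ?mulr_ge0 ?ler_wpM2l.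
rewrite [leRHS](_ : e = K * (e / K)); last by rewrite mulrCA divff ?mulr1 ?gt_eqF.
move: (e / K) eK => w w0.
by rewrite /K -subr_ge0 (_ : _ - _ = w) ?ltW//; ring.
Qed.

End Bilinear.

(** The derivative is a sum of two bounded bilinear maps into L(X; Z), evaluated at the pairs
    [fderiv f], [g] and [f], [fderiv g]. Quantifying over all bounded bilinear maps is what closes
    the induction; multiplication by scalars alone is not stable under differentiation. *)
Lemma Cn_on_bilinear n X Y1 Y2 Z (B : Y1 -> Y2 -> Z) (O : set X)
    (f : X -> Y1) (g : X -> Y2) : open O -> bounded_bilinear B ->
  Cn_on O n f -> Cn_on O n g -> Cn_on O n (fun x => B (f x) (g x)).
Proof.
move=> oO; elim: n Y1 Y2 Z B f g => [|n IH] Y1 Y2 Z B f g bB.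
  move=> /(Cn_on0P _ oO) fc /(Cn_on0P _ oO) gc; apply/Cn_on0P => // x Ox.
  by apply: continuous_bilinear => //; [exact: fc|exact: gc].
move=> Cf Cg; have [df Cdf] := Cf; have [dg Cdg] := Cg.
apply: (@Cn_onS _ _ _ _ _ (fun x => clin_of (fun h => B (fderiv f x h) (g x)) +
   clin_of (fun h => B (f x) (fderiv g x h)))) => //.
  by move=> x Ox; apply: fder_bilinear => //; apply: fderivP; [exact: df|exact: dg].
have bBl := @bounded_bilinear_lcomp X Y1 Y2 Z B bB.
have bBr := bounded_bilinear_flip
  (@bounded_bilinear_lcomp X Y2 Y1 Z (fun v u => B u v) (bounded_bilinear_flip bB)).
apply: Cn_onD => //.
  exact: (IH _ _ _ _ (fderiv f) g bBl Cdf (Cn_onW oO Cg)).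
exact: (IH _ _ _ _ f (fderiv g) bBr (Cn_onW oO Cf) Cdg).
Qed.

Lemma bounded_bilinear_scale Y : bounded_bilinear (fun (a : R) (y : Y) => a *: y).
Proof.
split=> [a b u v|v a b c|].
- by rewrite scalerDr !scalerA mulrC.
- by rewrite scalerDl scalerA.
by exists 1 => // a v; rewrite mul1r normrZ.
Qed.

Lemma Cn_onZ n X Y (O : set X) (a : X -> R) (f : X -> Y) : open O ->
  Cn_on O n a -> Cn_on O n f -> Cn_on O n (fun x => a x *: f x).
Proof. by move=> oO; apply: Cn_on_bilinear => //; exact: bounded_bilinear_scale. Qed.

Lemma bounded_bilinear_comp X Y Z :
  bounded_bilinear (fun (S : clin Y Z) (T : clin X Y) => comp_clin S T).
Proof.
split=> [S a T T'|T a S S'|].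
- by apply: clinP => x; rewrite clinD clinZ !comp_clinE clinD clinZ linearP.
- by apply: clinP => x; rewrite clinD clinZ !comp_clinE clinD clinZ.
exists 1 => // S T; apply: clin_norm_le; first by rewrite !mulr_ge0.
move=> x; rewrite comp_clinE mul1r (le_trans (clin_norm _ _))//.
rewrite -[leRHS]mulrA ler_wpM2l//.
exact: clin_norm.
Qed.

(** By the chain rule the derivative is the bilinear [comp_clin] of [fderiv g] composed with [f] and
    of [fderiv f]; only the target of [g] changes in the induction. *)
Lemma Cn_on_comp n X Y Z (O : set X) (V : set Y) (f : X -> Y) (g : Y -> Z) :
  open O -> open V -> (forall x, O x -> V (f x)) ->
  Cn_on O n f -> Cn_on V n g -> Cn_on O n (fun x => g (f x)).
Proof.
move=> oO oV fV; elim: n Z g => [|n IH] Z g.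
  move=> /(Cn_on0P _ oO) fc /(Cn_on0P _ oV) gc; apply/Cn_on0P => // x Ox.
  by apply: continuous_comp; [exact: fc|apply: gc; exact: fV].
move=> Cf [dg Cdg]; have [df Cdf] := Cf.
apply: (@Cn_onS _ _ _ _ _ (fun x => comp_clin (fderiv g (f x)) (fderiv f x))) => //.
  move=> x Ox; apply: fder_comp; apply: fderivP; first exact: df.
  exact/dg/fV.
apply: Cn_on_bilinear => //; first exact: bounded_bilinear_comp.
exact: IH (Cn_onW oO Cf) Cdg.
Qed.

End CnCalculus.

(** * A smooth Lipschitz step function on the line *)

Section SmoothStep.
Context {R : realType}.
Implicit Types (t s : R) (m n : nat).

Definition id_clin (X : normedModType R) : clin X X := clin_of id.

Lemma id_clinE (X : normedModType R) (x : X) : id_clin X x = x.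
Proof.
by rewrite /id_clin (@clin_ofE _ _ _ _ 1)// => y; rewrite mul1r.
Qed.

Lemma fder_is_derive (f : R -> R) t (d : R) :
  fder f t (d *: id_clin R) <-> is_derive t 1 f d.
Proof.
split.
  move=> h; have /fderP[df fd] := h; split; first exact: diff_derivable.
  by rewrite deriveE// -fderivE// fd clinZ id_clinE; apply: mulr1.
move=> [df fd]; apply/fderP; have := df => /derivable1_diffP df'.
split=> //; apply: clinP => h; rewrite fderivE// deriv1E//.
by rewrite derive1E fd clinZ id_clinE; apply: mulrC.
Qed.

(* The derivatives of [exp (- 1 / t)], extended by [0] for [t <= 0], are
   combinations of the members of this family. *)
Definition flat m t : R := if 0 < t then t^-1 ^+ m * expR (- t^-1) else 0.

Lemma flat_ge0 m t : 0 <= flat m t.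
Proof.
rewrite /flat; case: ifP => // t0.
by rewrite mulr_ge0 ?expR_ge0// exprn_ge0// invr_ge0 ltW.
Qed.

Lemma flat_le0 m t : t <= 0 -> flat m t = 0.
Proof. by rewrite /flat leNgt => /negbTE ->. Qed.

Lemma powM_expN_le n (u : R) : 0 <= u -> u ^+ n.+1 * expR (- u) <= n.+1`!%:R.
Proof.
move=> u0; rewrite expRN ler_pdivrMr ?expR_gt0// mulrC.
rewrite -ler_pdivrMr ?ltr0n ?fact_gt0//.
by apply: le_trans (expR_ge1Dxn n u0); rewrite lerDr.
Qed.

(** The quadratic bound is what gives each member of the family derivative [0] at the origin. *)
Lemma flat_le m t : flat m t <= (m.+2)`!%:R * t ^+ 2.
Proof.
rewrite /flat; case: ifPn => t0; last by rewrite mulr_ge0// sqr_ge0.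
rewrite -ler_pdivrMr ?exprn_gt0// mulrAC -exprVn -exprD addn2.
by apply: powM_expN_le; rewrite invr_ge0 ltW.
Qed.

Lemma flat_fder m t :
  fder (flat m) t ((flat m.+2 t - m%:R * flat m.+1 t) *: id_clin R).
Proof.
have [t0|t0|->] := ltgtP t 0.
- rewrite !flat_le0 ?ltW// mulr0 subrr scale0r.
  apply: (fder_near _ (fder_cst 0 t)); apply/nbhs_distP.
  exists (- t); first by rewrite oppr_gt0.
  move=> y; rewrite ltr_norml => /andP[_ yt]; rewrite flat_le0//.
  by rewrite -(lerD2r (- t)) sub0r ltW.
- apply: (@fder_near _ _ _ (fun s => s^-1 ^+ m * expR (- s^-1))).
    apply/nbhs_distP; exists t => // y; rewrite ltr_norml => /andP[yt _].
    by rewrite /flat; have -> : 0 < y by rewrite -(ltrD2r (- t)) sub0r.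
  apply/fder_is_derive; rewrite /flat t0.
  have dV : is_derive t 1 (fun s : R => s^-1) (- t^-1 ^+ 2).
    have dI : is_derive t 1 (fun s : R => s^-1) (- t ^- 2 *: 1).
      by apply: (@is_deriveV _ id t 1 1); rewrite gt_eqF.
    apply: (is_derive_eq dI).
    by rewrite -exprVn scaleNr; congr (- _); apply: mulr1.
  have dE : is_derive t 1 (fun s : R => expR (- s^-1)) (expR (- t^-1) * t^-1 ^+ 2).
    have dN : is_derive t 1 (fun s : R => - s^-1) (t^-1 ^+ 2).
      by have := is_deriveN dV; rewrite opprK.
    exact: (@is_derive1_comp _ expR _ t _ _ (is_derive_expR _) dN).
  rewrite (_ : (fun s => _) = (fun s : R => s^-1) ^+ m * (fun s => expR (- s^-1))).
    have dM := is_deriveM (is_deriveX m dV) dE; apply: (is_derive_eq dM).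
    rewrite !fctE /GRing.scale /= !exprS {dM}.
    case: m => [|m] /=; first by rewrite !mul0r expr0; ring.
    by rewrite exprS; ring.
  by apply/funext => s; rewrite !fctE.
rewrite !flat_le0// mulr0 subrr scale0r => e e0.
pose K : R := (m.+2)`!%:R.
have K0 : 0 < K by rewrite ltr0n fact_gt0.
exists (e / K); first by rewrite divr_gt0.
move=> y; rewrite subr0 [flat m 0]flat_le0// clin0 !subr0 ltr_pdivlMr// => yd.
rewrite ger0_norm ?flat_ge0// (le_trans (flat_le _ _))//.
rewrite -real_normK ?num_real// expr2 mulrA ler_wpM2r// mulrC; exact: ltW.
Qed.

Lemma Cn_flat n m : Cn_on setT n (flat m : R -> R).
Proof.
elim: n m => [|n IH] m.
  by apply/Cn_on0P => [|x _]; [exact: openT|exact: fder_continuous (flat_fder m x)].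
apply: (@Cn_onS _ _ _ _ _ _
  (fun t => (flat m.+2 t - m%:R * flat m.+1 t) *: id_clin R)); first exact: openT.
  by move=> x _; exact: flat_fder.
apply: Cn_onZ; [exact: openT| |exact/Cn_on_cst/openT].
apply: (@Cn_on_ext _ _ _ _ _ (fun t => flat m.+2 t + (- m%:R) *: flat m.+1 t)).
- exact: openT.
- by move=> t _; rewrite -mulNr.
apply: Cn_onD; [exact: openT|exact: IH|].
apply: (@Cn_onZ _ _ _ _ _ (fun=> - m%:R)); [exact: openT| |exact: IH].
exact/Cn_on_cst/openT.
Qed.

Lemma flat2_le t : flat 2 t <= 2.
Proof.
rewrite /flat; case: ifPn => // t0.
by rewrite (le_trans (@powM_expN_le 1 _ _))// invr_ge0 ltW.
Qed.

Lemma flat0_lipschitz t s : `|flat 0 t - flat 0 s| <= 2 * `|t - s|.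
Proof.
wlog ts : t s / s < t.
  have [ts|ts|->] := ltgtP t s; [|exact|by rewrite !subrr normr0 mulr0].
  by move=> h; rewrite distrC (distrC t); exact: h.
have D (x : R) : is_derive x 1 (flat 0) (flat 2 x).
  by apply/fder_is_derive; have := flat_fder 0 x; rewrite mul0r subr0.
have [|c _ ->] := @MVT R (flat 0) (flat 2) s t ts (fun x _ => D x).
  apply: continuous_subspaceT => x; exact: fder_continuous (flat_fder 0 x).
by rewrite normrM ler_wpM2r// ger0_norm ?flat_ge0// flat2_le.
Qed.

Lemma Cn_inv n : Cn_on [set t : R | 0 < t] n (fun t => t^-1 : R).
Proof.
have oP : open [set t : R | 0 < t] by exact: open_gt.
have D t : 0 < t -> fder (fun t => t^-1 : R) t ((- (t^-1 *: t^-1)) *: id_clin R).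
  move=> t0; apply/fder_is_derive; 
  have dI : is_derive t 1 (fun s : R => s^-1) (- t ^- 2 *: 1).
    by apply: (@is_deriveV _ id t 1 1); rewrite gt_eqF.
  apply: (is_derive_eq dI).
  by rewrite -exprVn scaleNr; congr (- _); apply: mulr1.
elim: n => [|n IH].
  by apply/Cn_on0P => // t t0; exact: fder_continuous (D t t0).
apply: (Cn_onS oP D).
apply: Cn_onZ => //; last exact: Cn_on_cst.
apply: (@Cn_on_ext _ _ _ _ _ (fun t => (-1) *: (t^-1 *: t^-1))) => //.
  by move=> t _; rewrite scaleN1r.
apply: (@Cn_onZ _ _ _ _ _ (fun=> -1)) => //; first exact: Cn_on_cst.
exact: Cn_onZ.
Qed.

Lemma Cn_affine n (X : normedModType R) (O : set X) (a : R) (c : X) : open O ->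
  Cn_on O n (fun x => a *: (x - c)).
Proof.
move=> oO; apply: Cn_onZ => //; first exact: Cn_on_cst.
apply: Cn_onD => //; last exact: Cn_on_cst.
apply: Cn_on_ext (Cn_on_clin n (id_clin X) oO) => // x _.
exact: id_clinE.
Qed.

(** The plateaus ending at [1 / 4] and [3 / 4] leave room for an argument known only up to [1 / 8]
    to be near [0] or [1]; the global Lipschitz bound is inherited by the bump functions. *)
Lemma smooth_step : exists2 theta : R -> R,
  [/\ forall n, Cn_on setT n theta, forall t, 0 <= theta t <= 1,
      forall t, t <= 1 / 4 -> theta t = 1 & forall t, 3 / 4 <= t -> theta t = 0] &
  exists2 L : R, 0 <= L & forall t s, `|theta t - theta s| <= L * `|t - s|.
Proof.
pose p t : R := flat 0 (3 / 4 - t); pose q t : R := flat 0 (t - 1 / 4).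
have p0 t : 0 <= p t by exact: flat_ge0.
have q0 t : 0 <= q t by exact: flat_ge0.
(* At every [t] one of [3 / 4 - t] and [t - 1 / 4] is at least [1 / 4], where [exp (- 1 / s)] is at
   least [exp (- 4)]; this bounds the denominator [p + q] away from [0]. *)
have flat4 (t : R) : 1 / 4 <= t -> expR (- 4) <= flat 0 t.
  move=> t4; have t0 : 0 < t by lra.
  rewrite /flat t0 expr0 mul1r ler_expR lerN2 -[4]invrK lef_pV2 ?posrE//; lra.
have pq t : expR (- 4) <= p t + q t.
  have [t2|t2] := leP t (1 / 2).
    by rewrite (le_trans (@flat4 (3 / 4 - t) _)) ?lerDl//; lra.
  by rewrite (le_trans (@flat4 (t - 1 / 4) _)) ?lerDr//; lra.
have e0 : 0 < expR (- 4) :> R by exact: expR_gt0.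
have pq0 t : 0 < p t + q t by exact: lt_le_trans (pq t).
exists (fun t => p t / (p t + q t)); [split|].
- move=> n; have oT : open [set: R] by exact: openT.
  have Cp : Cn_on setT n p.
    apply: (@Cn_on_comp _ n _ _ _ setT setT (fun t => 3 / 4 - t) (flat 0)) => //.
      apply: (@Cn_on_ext _ _ _ _ _ (fun t => (-1) *: (t - 3 / 4))) => //.
        by move=> t _; rewrite scaleN1r opprB.
      exact: Cn_affine.
    exact: Cn_flat.
  have Cq : Cn_on setT n q.
    apply: (@Cn_on_comp _ n _ _ _ setT setT (fun t => t - 1 / 4) (flat 0)) => //.
      apply: (@Cn_on_ext _ _ _ _ _ (fun t => 1 *: (t - 1 / 4))) => //.
        by move=> t _; rewrite scale1r.
      exact: Cn_affine.
    exact: Cn_flat.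
  apply: (@Cn_onZ _ n _ _ setT p) => //.
  have oP : open [set t : R | 0 < t] by exact: open_gt.
  have Cpq : Cn_on setT n (fun t => p t + q t) by exact: Cn_onD.
  exact: (@Cn_on_comp _ n _ _ _ _ _ _ _ oT oP (fun x _ => pq0 x) Cpq (Cn_inv n)).
- by move=> t; rewrite divr_ge0 ?(ltW (pq0 t))//= ler_pdivrMr// mul1r lerDl.
- move=> t t4; have qt : q t = 0 by apply: flat_le0; lra.
  by have := pq0 t; rewrite qt addr0 => pt; rewrite divff// gt_eqF.
- by move=> t t4; rewrite /p flat_le0 ?mul0r//; lra.
exists (4 / expR (- 4)); first by rewrite divr_ge0// ltW.
move=> t s.
(* Written this way the increments of [p] and [q], each at most [2 * |t - s|], carry weights in
   [0, 1], and only one denominator has to be bounded below. *)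
have -> : p t / (p t + q t) - p s / (p s + q s) =
    (p t / (p t + q t) * (q s - q t) + q t / (p t + q t) * (p t - p s)) / (p s + q s).
  by field; rewrite !gt_eqF.
rewrite normrM normfV (gtr0_norm (pq0 s)) ler_pdivrMr//.
apply: (@le_trans _ _ (4 * `|t - s|)); last first.
  rewrite (_ : _ * _ * _ = 4 * `|t - s| * ((p s + q s) / expR (- 4))); last by ring.
  by rewrite ler_peMr ?mulr_ge0// ler_pdivlMr// mul1r.
have l1 : `|q s - q t| <= 2 * `|t - s|.
  rewrite (le_trans (flat0_lipschitz _ _))// distrC ler_wpM2l//.
  by rewrite opprB addrA subrK.
have l2 : `|p t - p s| <= 2 * `|t - s|.
  rewrite (le_trans (flat0_lipschitz _ _))//.
  by rewrite opprB addrC addrA subrK distrC.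
rewrite (le_trans (ler_normD _ _))// (normrM (p t / _)) (normrM (q t / _)).
have c1 : `|p t / (p t + q t)| <= 1.
  by rewrite ger0_norm ?divr_ge0 ?(ltW (pq0 t))// ler_pdivrMr// mul1r lerDl.
have c2 : `|q t / (p t + q t)| <= 1.
  by rewrite ger0_norm ?divr_ge0 ?(ltW (pq0 t))// ler_pdivrMr// mul1r lerDr.
have n1 := ler_piMl (normr_ge0 (q s - q t)) c1.
have n2 := ler_piMl (normr_ge0 (p t - p s)) c2.
lra.
Qed.

End SmoothStep.

(** * Norming functionals from minimal sublinear functionals *)

Section HahnBanach.
Context {R : realType} (Y : normedModType R).
Implicit Types (p q : Y -> R).

Definition sublinear p :=
  [/\ forall x y, p (x + y) <= p x + p y,
      forall (a : R) x, 0 < a -> p (a *: x) <= a * p x & p 0 = 0].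

Lemma sublinearZ p (a : R) x : sublinear p -> 0 <= a -> p (a *: x) = a * p x.
Proof.
move=> [_ pZ p0]; rewrite le_eqVlt => /predU1P[<-|a0].
  by rewrite scale0r mul0r.
apply/eqP; rewrite eq_le pZ//=.
rewrite -ler_pdivlMl//; apply: le_trans (pZ _ _ _); last by rewrite invr_gt0.
by rewrite scalerA mulVf ?gt_eqF// scale1r.
Qed.

Lemma sublinearN p x : sublinear p -> - p (- x) <= p x.
Proof.
by move=> [pD _ p0]; rewrite lerNl -subr_ge0 opprK addrC -p0 -(subrr x) pD.
Qed.

(* The largest sublinear functional below [p] taking the value [- p z] at [- z]. *)
Definition sublinear_lower p (z x : Y) : R :=
  inf [set p (x + t *: z) - t * p z | t in [set t : R | 0 <= t]].

Section Lower.
Variables (p : Y -> R) (z : Y).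
Hypothesis sp : sublinear p.

Lemma sublinear_lower_lbound x :
  lbound [set p (x + t *: z) - t * p z | t in [set t : R | 0 <= t]] (- p (- x)).
Proof.
move=> _ [t /= t0 <-]; rewrite -(sublinearZ _ sp t0); have [pD _ _] := sp.
by have := pD (x + t *: z) (- x); rewrite addrAC subrr add0r; lra.
Qed.

Lemma sublinear_lower_le x (t : R) : 0 <= t ->
  sublinear_lower p z x <= p (x + t *: z) - t * p z.
Proof.
move=> t0; apply: ge_inf; last by exists t.
by exists (- p (- x)); exact: sublinear_lower_lbound.
Qed.

Lemma sublinear_lower_ge x m :
  (forall t : R, 0 <= t -> m <= p (x + t *: z) - t * p z) ->
  m <= sublinear_lower p z x.
Proof.
move=> h; apply: lb_le_inf; first by exists (p (x + 0 *: z) - 0 * p z), 0 => /=.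
by move=> _ [t /= t0 <-]; exact: h.
Qed.

Lemma sublinear_lower_sublinear : sublinear (sublinear_lower p z).
Proof.
have [pD _ p0] := sp; split.
- move=> x y; rewrite -lerBlDr; apply: sublinear_lower_ge => s s0.
  rewrite lerBlDr -lerBlDl; apply: sublinear_lower_ge => t t0.
  rewrite lerBlDl (le_trans (sublinear_lower_le _ (addr_ge0 s0 t0)))//.
  by have := pD (x + s *: z) (y + t *: z); rewrite addrACA -scalerDl; lra.
- move=> a x a0; rewrite -ler_pdivrMl//; apply: sublinear_lower_ge => t t0.
  rewrite ler_pdivrMl// (le_trans (sublinear_lower_le _ (mulr_ge0 (ltW a0) t0)))//.
  by rewrite -scalerA -scalerDr (sublinearZ _ sp (ltW a0)) mulrBr mulrA.
apply/eqP; rewrite eq_le; apply/andP; split.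
  by rewrite (le_trans (sublinear_lower_le _ (lexx 0)))// scale0r addr0 p0 mul0r subr0.
apply: sublinear_lower_ge => t t0.
by rewrite add0r (sublinearZ _ sp t0) subrr.
Qed.

Lemma sublinear_lower_le_self x : sublinear_lower p z x <= p x.
Proof.
by rewrite (le_trans (sublinear_lower_le _ (lexx 0)))// scale0r addr0 mul0r subr0.
Qed.

Lemma sublinear_lowerN : sublinear_lower p z (- z) <= - p z.
Proof.
have [_ _ p0] := sp.
by rewrite (le_trans (sublinear_lower_le _ (ler01)))// scale1r addNr p0 mul1r add0r.
Qed.

End Lower.

(** Zorn's lemma for the reversed pointwise order. The infimum of a chain is finite, being at least
    [- p (- x)] at [x], and it is subadditive because the smaller of two members serves both
    arguments. *)
Lemma minimal_sublinear p : sublinear p ->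
  exists q, [/\ sublinear q, forall x, q x <= p x &
    forall r, sublinear r -> (forall x, r x <= q x) -> r = q].
Proof.
move=> sp.
pose P q := `[< sublinear q /\ forall x, q x <= p x >].
pose T := {q | P q}.
pose rel (q r : T) := `[< forall x, sval r x <= sval q x >].
have Pp : P p by apply/asboolP.
have TP (q : T) : sublinear (sval q) /\ forall x, sval q x <= p x.
  by case: q => q /= /asboolP.
have [| | | |q qmin] := @Zorn T rel.
- by move=> q; apply/asboolP.
- move=> q r s /asboolP h1 /asboolP h2; apply/asboolP => x.
  exact: le_trans (h2 x) (h1 x).
- move=> q r /asboolP h1 /asboolP h2; apply: val_inj => /=; apply/funext => x.
  by apply/eqP; rewrite eq_le h1 h2.
- move=> A Atot.
  have [[q0 Aq0]|A0] := pselect (A !=set0); last first.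
    by exists (exist _ p Pp) => q Aq; case: A0; exists q.
  have [m m_le m_ge] : exists2 m : Y -> R,
      forall (q : T) x, A q -> m x <= sval q x &
      forall x c, (forall q : T, A q -> c <= sval q x) -> c <= m x.
    exists (fun x => inf [set sval q x | q in A]) => [q x Aq|x c h].
      apply: ge_inf; last by exists q.
      exists (- p (- x)) => _ [r Ar <-]; have [sr rp] := TP r.
      by rewrite (le_trans _ (sublinearN _ sr))// lerN2.
    apply: lb_le_inf; first by exists (sval q0 x), q0.
    by move=> _ [q Aq <-]; exact: h.
  have Pm : P m.
    apply/asboolP; split; last first.
      by move=> x; rewrite (le_trans (m_le q0 x Aq0))//; have [_] := TP q0.
    split.
    + move=> x y; rewrite -lerBlDr; apply: (m_ge x _) => q Aq.
      rewrite lerBlDr -lerBlDl; apply: (m_ge y _) => r Ar; rewrite lerBlDl.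
      have [[qD _ _] _] := TP q; have [[rD _ _] _] := TP r.
      have [/asboolP qr|/asboolP rq] := Atot _ _ Aq Ar.
        by rewrite (le_trans (m_le r _ Ar))// (le_trans (rD _ _))// lerD2r.
      by rewrite (le_trans (m_le q _ Aq))// (le_trans (qD _ _))// lerD2l.
    + move=> a x a0; rewrite -ler_pdivrMl//; apply: m_ge => q Aq.
      have [[_ qZ _] _] := TP q.
      by rewrite ler_pdivrMl// (le_trans (m_le q _ Aq))// qZ.
    apply/eqP; rewrite eq_le; apply/andP; split.
      by rewrite (le_trans (m_le q0 _ Aq0))//; have [[_ _ ->]] := TP q0.
    by apply: m_ge => q Aq; have [[_ _ ->]] := TP q.
  by exists (exist _ m Pm) => q Aq; apply/asboolP => x /=; exact: m_le.
have [sq qp] := TP q; exists (sval q); split=> // r sr rq.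
have Pr : P r by apply/asboolP; split=> // x; exact: le_trans (rq x) (qp x).
by rewrite -(qmin (exist _ r Pr))//; apply/asboolP.
Qed.

(** Minimality of [p] against [sublinear_lower p y] forces [p (- y) = - p y] for every [y], and an
    odd sublinear functional is linear. Starting below the [sublinear_lower] of the norm at [y0]
    makes [p (- y0)] at most minus the norm of [y0], which gives the value at [y0]. *)
Theorem norming_functional (y0 : Y) :
  exists l : clin Y R, (forall y, `|l y| <= `|y|) /\ l y0 = `|y0|.
Proof.
have sN : sublinear (fun y : Y => `|y|).
  split; [exact: ler_normD| |exact: normr0].
  by move=> a x a0; rewrite normrZ gtr0_norm.
have [p [sp pN pmin]] := minimal_sublinear (sublinear_lower_sublinear y0 sN).
have [pD _ p0] := sp.
have pE y : p (- y) = - p y.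
  apply/eqP; rewrite eq_le [X in _ && X]lerNl sublinearN// andbT.
  have E := pmin _ (sublinear_lower_sublinear y sp) (sublinear_lower_le_self y sp).
  by have := sublinear_lowerN y sp; rewrite E.
have pA x y : p (x + y) = p x + p y.
  apply/eqP; rewrite eq_le pD/= -lerBrDr -pE.
  by rewrite -{1}(addrK y x) pD.
have ple y : p y <= `|y| by rewrite (le_trans (pN y))// sublinear_lower_le_self.
have plin : linear (p : Y -> R).
  move=> a x y; rewrite pA; congr (_ + _).
  have [a0|a0] := leP 0 a; first exact: sublinearZ.
  by rewrite -[a]opprK scaleNr pE (sublinearZ _ sp) ?mulNr ?scaleNr// oppr_ge0 ltW.
have pb y : `|p y| <= 1 * `|y|.
  by rewrite mul1r ler_norml ple andbT lerNl -pE -(normrN y) ple.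
exists (clin_of p); rewrite (clin_ofE plin pb); split.
  by move=> y; rewrite (le_trans (pb y))// mul1r.
apply/eqP; rewrite eq_le ple/= -lerN2 -pE (le_trans (pN _))//.
exact: sublinear_lowerN.
Qed.

End HahnBanach.

(** * Smooth Lipschitz bump functions from (LE) and (LA_k) *)

Section Separation.
Context {R : realType}.
Implicit Types X Y : normedModType R.

Lemma lipschitz_onP X Y (A : set X) (L : R) (f : X -> Y) :
  L.-lipschitz_A f <->
  forall x y, A x -> A y -> `|f x - f y| <= L * `|x - y|.
Proof.
split=> [h x y Ax Ay|h [x y] [/= Ax Ay]]; last exact: h.
by have := h (x, y); apply.
Qed.

(* It suffices to treat one smoothness order at a time, all of them if [k] is
   [None]. *)
Definition smooth_order (k : option nat) (n : nat) : Prop :=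
  if k is Some m then n = m else True.

Lemma Ck_onP X Y (O : set X) k (f : X -> Y) :
  Ck_on O k f <-> forall n, smooth_order k n -> Cn_on O n f.
Proof.
case: k => [m|]; split=> h; first by move=> n ->.
- exact: (h m).
- by move=> n _; exact: h.
- by move=> n; exact: (h n).
Qed.

Lemma propLE_ext X Y : propLE X Y -> exists2 C : R, 0 < C &
  forall (A : set X) (L : R) (f : X -> Y), 0 <= L ->
    (forall x y, A x -> A y -> `|f x - f y| <= L * `|x - y|) ->
    exists2 g : X -> Y, (forall x y, `|g x - g y| <= C * L * `|x - y|) &
      forall x, A x -> g x = f x.
Proof.
move=> [C C0 h]; exists C => // A L f L0 /lipschitz_onP/(h _ _ _ L0)[g gl gf].
exists g; last by move=> x Ax; apply: gf; rewrite inE.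
by move=> x y; apply: (lipschitz_onP setT _ g).1.
Qed.

(** Rescaling multiplies the Lipschitz constant by [r] and back by [r^-1], so one constant [C]
    serves balls of all centres and radii. *)
Lemma propLA_ball X Y k : propLA k X Y -> exists2 C : R, 0 <= C &
  forall (c : X) (r L e : R) (f : X -> Y), 0 < r -> 0 <= L -> 0 < e ->
    (forall x y, ball c r x -> ball c r y -> `|f x - f y| <= L * `|x - y|) ->
    exists g : X -> Y,
      [/\ forall x y, ball c r x -> ball c r y ->
            `|g x - g y| <= C * L * `|x - y|,
          Ck_on (ball c r) k g &
          forall x, ball c r x -> `|f x - g x| <= e].
Proof.
move=> [C C0 h]; exists C => // c r L e f r0 L0 e0 fL.
have rn0 : r != 0 by rewrite gt_eqF.
pose to x := r^-1 *: (x - c); pose from u := c + r *: u.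
have toK x : from (to x) = x.
  by rewrite /from /to scalerA divff// scale1r addrC subrK.
have to_ball x : ball c r x -> unit_ball (to x).
  rewrite /unit_ball !ball_distE subr0 /to normrZ gtr0_norm ?invr_gt0//.
  by rewrite mulrC ltr_pdivrMr// mul1r.
have from_ball u : unit_ball u -> ball c r (from u).
  rewrite /unit_ball !ball_distE subr0 /from addrC addKr normrZ gtr0_norm//.
  by rewrite gtr_pMr.
have fromB u v : from u - from v = r *: (u - v).
  by rewrite /from opprD addrACA subrr add0r scalerBr.
have [||g [gl Cg ge]] := h (L * r) (f \o from) e _ _ e0.
- exact: mulr_ge0 L0 (ltW r0).
- apply/lipschitz_onP => u v Bu Bv /=.
  rewrite (le_trans (fL _ _ (from_ball _ Bu) (from_ball _ Bv)))//.
  by rewrite fromB normrZ gtr0_norm// mulrA.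
have {}gl := (lipschitz_onP _ _ _).1 gl; exists (g \o to); split.
- move=> x y Bx By /=; rewrite (le_trans (gl _ _ (to_ball _ Bx) (to_ball _ By)))//.
  rewrite /to -scalerBr opprB addrA subrK normrZ gtr0_norm ?invr_gt0//.
  by rewrite !mulrA -(mulrA (C * L)) divff ?mulr1.
- apply/Ck_onP => n kn; have {}Cg := (Ck_onP _ _ _).1 Cg n kn.
  apply: (@Cn_on_comp _ n _ _ _ (ball c r) (@unit_ball R X) to g) => //.
  + exact: ball_open.
  + exact: ball_open.
  + exact/Cn_affine/ball_open.
move=> x Bx /=; rewrite -{1}(toK x) -lee_fin (le_trans _ ge)//.
by apply: ereal_sup_ubound; exists (to x) => //; exact: to_ball.
Qed.

Section Bump.
Variables (X Y : normedModType R) (k : option nat) (y0 : Y).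
Hypotheses (y0N0 : y0 != 0) (hLE : propLE X Y) (hLA : propLA k X Y).

(** The map equal to [0] on [E] and to a unit vector [v] on the points at distance at least [r] from
    [E] is [r^-1]-Lipschitz. (LE) extends it, (LA_k) smooths it up to [1 / 8], and a functional with
    [l v = 1] followed by the step function gives real values that are constant near [E].
    Boundedness of [E] reduces everything to a single ball, as (LA_k) requires. *)
Lemma smooth_separation (E : set X) (R0 r : R) : 0 < r ->
  (forall x, E x -> `|x| <= R0) -> exists zeta : X -> R,
  [/\ forall n, smooth_order k n -> Cn_on setT n zeta,
      forall x, 0 <= zeta x <= 1,
      forall x, E x -> \forall y \near x, zeta y = 1,
      forall x, (forall a, E a -> r <= `|x - a|) -> zeta x = 0 &
      exists2 L : R, 0 <= L & forall x y, `|zeta x - zeta y| <= L * `|x - y|].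
Proof.
(* All points of norm at least [R2] are at distance at least [r] from [E]. The function thus already
   vanishes on the shell between [R2] and [R1] and can be continued by [0] beyond [R1], where (LA_k)
   gives nothing. *)
move=> r0 ER0; pose R2 := `|R0| + r; pose R1 := R2 + r.
have R20 : 0 < R2 by rewrite ltr_wpDl.
have R10 : 0 < R1 by rewrite addr_gt0.
pose v := `|y0|^-1 *: y0.
have v1 : `|v| = 1 by rewrite normrZ normfV normr_id mulVf ?normr_eq0.
have [l [lN lv]] := norming_functional v; rewrite v1 in lv.
have [CE CE0 LE] := propLE_ext hLE; have [CA CA0 LA] := propLA_ball hLA.
have [theta [Ctheta theta01 theta1 theta0] [Lt Lt0 thetaL]] := @smooth_step R.
pose F : set X := [set x | forall a, E a -> r <= `|x - a|].
have FR2 x : R2 <= `|x| -> F x.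
  move=> xR a /ER0 aR; have := lerB_dist x a.
  by have := ler_norm R0; rewrite /R2 in xR; lra.
have EF x : E x -> ~ F x by move=> Ex /(_ x Ex); rewrite subrr normr0 leNgt r0.
pose f0 x : Y := if x \in E then 0 else v.
have [||f1 f1L f1f0] := LE (E `|` F) r^-1 f0; first by rewrite invr_ge0 ltW.
  have one x y : E x -> F y -> 1 <= r^-1 * `|x - y|.
    by move=> Ex /(_ x Ex) h; rewrite mulrC ler_pdivlMr// mul1r distrC.
  have n0 x y : 0 <= r^-1 * `|x - y : X| by rewrite mulr_ge0// invr_ge0 ltW.
  have f0E x : E x -> f0 x = 0 by move=> Ex; rewrite /f0 mem_set.
  have f0F x : F x -> f0 x = v.
    by move=> Fx; rewrite /f0 memNset// => Ex; exact: EF Ex Fx.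
  move=> x y [Ex|Fx] [Ey|Fy].
  - by rewrite !f0E// subrr normr0.
  - by rewrite f0E// f0F// sub0r normrN v1 one.
  - by rewrite f0F// f0E// subr0 v1 distrC one.
  - by rewrite !f0F// subrr normr0.
have e0 : 0 < 1 / 8 :> R by lra.
have rV : 0 < r^-1 by rewrite invr_gt0.
have [g [gL Cg gf]] := LA 0 R1 (CE * r^-1) (1 / 8) f1 R10
  (mulr_ge0 (ltW CE0) (ltW rV)) e0 (fun x y _ _ => f1L x y).
pose u x := l (g x).
have BE x : ball (0 : X) R1 x = (`|x| < R1) :> Prop by rewrite ball_distE subr0.
have ER1 x : E x -> `|x| < R1.
  by move=> /ER0 xR; have := ler_norm R0; rewrite /R1 /R2; lra.
have uE x : E x -> `|u x| <= 1 / 8.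
  move=> Ex; have xB : ball (0 : X) R1 x by rewrite BE; exact: ER1.
  have := gf _ xB; rewrite f1f0; last by left.
  rewrite /f0 mem_set// sub0r normrN; exact: le_trans (lN _).
have uF x : F x -> `|x| < R1 -> 7 / 8 <= u x.
  rewrite -BE => Fx xB; have := gf _ xB; rewrite f1f0; last by right.
  rewrite /f0 memNset; last by move=> Ex; exact: EF Ex Fx.
  move=> h; have := le_trans (lN _) h.
  by rewrite linearB /= lv /u ler_norml => /andP[]; lra.
pose L2 := CA * (CE / r).
have L20 : 0 <= L2 by rewrite mulr_ge0// divr_ge0 ?ltW.
have uL x y : `|x| < R1 -> `|y| < R1 -> `|u x - u y| <= L2 * `|x - y|.
  rewrite -!BE => xB yB; rewrite /u -linearB /=.
  by rewrite (le_trans (lN _))// gL.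
pose zeta x := if `|x| < R1 then theta (u x) else 0.
have zetaF x : F x -> zeta x = 0.
  move=> Fx; rewrite /zeta; case: ifP => // xR; apply: theta0.
  by have := uF x Fx xR; lra.
have zeta01 x : 0 <= zeta x <= 1.
  by rewrite /zeta; case: ifP => // _; rewrite lexx ler01.
exists zeta; split=> //.
- move=> n kn; apply: Cn_on_local; first exact: openT.
  move=> x _; have [xR|xR] := ltP `|x| R1; last first.
    exists (ball x r), (fun=> 0); split=> //.
    + exact: ball_open.
    + exact: ballxx.
    + exact/Cn_on_cst/ball_open.
    move=> y; rewrite ball_distE => yr; apply/zetaF/FR2.
    have := lerB_dist x y; rewrite distrC in yr.
    by rewrite /R1 in xR; lra.
  exists (ball 0 R1), (fun x => theta (u x)); split.
  + exact: ball_open.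
  + by rewrite BE.
  + have oB : open (ball (0 : X) R1) by exact: ball_open.
    have oT : open [set: R] by exact: openT.
    have oTY : open [set: Y] by exact: openT.
    have Cu : Cn_on (ball 0 R1) n u.
      have Cgn := (Ck_onP _ _ _).1 Cg n kn.
      exact: (Cn_on_comp oB oTY (fun _ _ => I) Cgn (Cn_on_clin n l oTY)).
    exact: (Cn_on_comp oB oT (fun _ _ => I) Cu (Ctheta n)).
  by move=> y; rewrite BE /zeta => ->.
- move=> x Ex; apply/nbhs_distP.
  (* [u] is at most [1 / 8] in absolute value at [x] and moves by at most [1 / 8] within the second
     radius, so it stays on the plateau of [theta] that ends at [1 / 4]. *)
  exists (Num.min (R1 - `|x|) ((8 * (L2 + 1))^-1)).
    by rewrite lt_min subr_gt0 ER1// invr_gt0 mulr_gt0// ltr_wpDl.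
  move=> y; rewrite lt_min => /andP[y1 y2].
  have yR : `|y| < R1 by have := lerB_dist y x; lra.
  rewrite /zeta yR theta1//.
  have := uL y x yR (ER1 _ Ex); have := uE _ Ex.
  have : L2 * `|y - x| <= 1 / 8.
    rewrite -[_^-1]mul1r ltr_pdivlMr ?mulr_gt0 ?ltr_wpDl// in y2.
    by have := normr_ge0 (y - x); nra.
  by rewrite !ler_norml => ? /andP[? ?] /andP[? ?]; lra.
exists (Lt * L2 + r^-1); first by rewrite addr_ge0 ?mulr_ge0// ltW.
(* Either [x] lies in the shell, where both values are [0], or [x] and [y] are at least [r] apart,
   and values in [0, 1] differ by at most [1]. *)
have far x y : `|x| < R1 -> R1 <= `|y| -> `|zeta x - zeta y| <= r^-1 * `|x - y|.
  move=> xR yR; rewrite [zeta y]zetaF ?subr0; last by apply: FR2; rewrite /R1 in yR; lra.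
  have [xR2|xR2] := leP R2 `|x|.
    by rewrite zetaF ?normr0 ?mulr_ge0 ?(ltW rV)//; exact: FR2.
  have /andP[z0 z1] := zeta01 x; rewrite ger0_norm// (le_trans z1)//.
  rewrite mulrC ler_pdivlMr// mul1r; have := lerB_dist y x; rewrite distrC.
  by rewrite /R1 in yR; lra.
have n0 x y : 0 <= `|x - y : X| by [].
move=> x y; have [xR|xR] := ltP `|x| R1; have [yR|yR] := ltP `|y| R1.
- rewrite /zeta xR yR (le_trans (thetaL _ _))//.
  rewrite mulrDl ler_wpDr ?mulr_ge0 ?(ltW rV)// -mulrA ler_wpM2l//.
  exact: uL.
- by rewrite (le_trans (far _ _ xR yR))// ler_wpM2r// lerDr mulr_ge0.
- by rewrite distrC (distrC x) (le_trans (far _ _ yR xR))// ler_wpM2r// lerDr mulr_ge0.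
have far0 z : R1 <= `|z| -> zeta z = 0.
  by move=> zR; apply/zetaF/FR2; rewrite (le_trans _ zR)// lerDl ltW.
by rewrite !far0// subrr normr0 mulr_ge0// addr_ge0 ?mulr_ge0// ltW.
Qed.

End Bump.
End Separation.

(** * Countable Lipschitz partitions of unity subordinate to a family of balls *)

Section PartitionOfUnity.
Context {R : realType}.

Lemma well_ordered_choice (X : choiceType) : exists2 W : X -> X -> Prop,
  (forall a b, W a b -> W b a -> a = b) &
  forall A : set X, A !=set0 -> exists2 a, A a & forall b, A b -> W a b.
Proof.
have [W wo] := wochoice.well_ordering_principle X; exists W.
  move=> a b Wab Wba.
  apply: (@wochoice.wo_chain_antisymmetric _ W predT) => //; last by apply/andP.
  by move=> A _; exact: wo.
move=> A [x Ax]; have [|a [[Aa amin] _]] := wo [pred x | `[< A x >]].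
  by exists x; apply/asboolP.
exists a; first by move: Aa => /asboolP.
by move=> b Ab; apply: amin; apply/asboolP.
Qed.

Lemma lipschitzM01 (X : normedModType R) (f g : X -> R) (K L : R) : 0 <= K ->
  (forall x, 0 <= f x <= 1) -> (forall x, 0 <= g x <= 1) ->
  (forall x y, `|f x - f y| <= K * `|x - y|) ->
  (forall x y, `|g x - g y| <= L * `|x - y|) ->
  forall x y, `|f x * g x - f y * g y| <= (K + L) * `|x - y|.
Proof.
move=> K0 f01 g01 fK gL x y.
have -> : f x * g x - f y * g y = (f x - f y) * g x + f y * (g x - g y) by ring.
rewrite (le_trans (ler_normD _ _))// !normrM mulrDl.
have /andP[g0 g1] := g01 x; have /andP[f0 f1] := f01 y.
rewrite (ger0_norm g0) (ger0_norm f0) lerD//.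
  by rewrite (le_trans _ (fK x y))// ler_piMr.
by rewrite (le_trans _ (gL x y))// ler_piMl.
Qed.

Variables (X Y : normedModType R) (k : option nat) (y0 : Y).
Hypotheses (y0N0 : y0 != 0) (hLE : propLE X Y) (hLA : propLA k X Y).

(** Countably many functions suffice for an uncountable cover because one [phi n] serves all balls
    at once: its support splits into uniformly separated pieces, and the locally constant [c n]
    names the ball containing the piece near [x]. With [phi n = zeta n * pi n] the partial sums are
    [1 - pi n], which is [1] as soon as an earlier [zeta N] equals [1]. *)
Lemma partition_of_unity (O : set X) (r : X -> R) : (forall x, O x -> 0 < r x) ->
  exists (phi : nat -> X -> R) (c : nat -> X -> X),
  [/\ forall n m, smooth_order k m -> Cn_on setT m (phi n),
      forall n x, 0 <= phi n x,
      forall n, exists2 L : R, 0 <= L & forall x y, `|phi n x - phi n y| <= L * `|x - y|,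
      forall x, O x -> exists N, \forall y \near x,
        (forall n, (N <= n)%N -> phi n y = 0) /\ \sum_(i < N) phi i y = 1 &
      forall n x, (\forall y \near x, phi n y = 0) \/
        O (c n x) /\ \forall y \near x, c n y = c n x /\ ball (c n x) (r (c n x)) y].
Proof.
move=> r0; have [W Wanti Wmin] := well_ordered_choice X.
have /choice[s hs] : forall x, exists a, O x -> [/\ O a, ball a (r a) x &
    forall b, O b -> ball b (r b) x -> W a b].
  move=> x; have [Ox|nOx] := pselect (O x); last by exists x.
  have [|a [Oa ax] amin] := Wmin [set a | O a /\ ball a (r a) x].
    by exists x; split=> //; apply: ballxx; exact: r0.
  by exists a => _; split=> // b Ob bx; apply: amin.
pose e n : R := n.+1%:R^-1.
have e0 n : 0 < e n by rewrite invr_gt0 ltr0n.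
(* [s x] is the first centre, in the well-order [W], whose ball contains [x]. The bound on the norm
   makes [E n] admissible for [smooth_separation]. *)
pose E n : set X := [set x | [/\ O x, `|x| <= n%:R &
  forall y, `|y - x| < e n -> ball (s x) (r (s x)) y]].
(* Stone's observation: pieces of [E n] belonging to distinct members of the
   cover are uniformly far apart. *)
have Esep n x y : E n x -> E n y -> `|x - y| < e n -> s x = s y.
  move=> [Ox _ xs] [Oy _ ys] xy.
  have [Osx _ sxmin] := hs x Ox; have [Osy _ symin] := hs y Oy.
  by apply: Wanti; [apply: sxmin => //; exact: ys|
    apply: symin => //; apply: xs; rewrite distrC].
have /choice[zeta hz] : forall n, exists zeta : X -> R,
    [/\ forall m, smooth_order k m -> Cn_on setT m zeta,
      forall x, 0 <= zeta x <= 1,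
      forall x, E n x -> \forall y \near x, zeta y = 1,
      forall x, (forall a, E n a -> e n / 8 <= `|x - a|) -> zeta x = 0 &
      exists2 L : R, 0 <= L & forall x y, `|zeta x - zeta y| <= L * `|x - y|].
  move=> n; apply: (smooth_separation y0N0 hLE hLA (R0 := n%:R)).
    by rewrite divr_gt0.
  by move=> x [].
pose pi n x := \prod_(m < n) (1 - zeta m x).
have piS n x : pi n.+1 x = pi n x * (1 - zeta n x) by rewrite /pi big_ord_recr.
have zeta01 n x : 0 <= zeta n x <= 1 by have [_ /(_ x)] := hz n.
have zetaC01 n x : 0 <= 1 - zeta n x <= 1.
  by have /andP[z0 z1] := zeta01 n x; rewrite subr_ge0 z1 gerBl.
have pi01 n x : 0 <= pi n x <= 1.
  elim: n => [|n /andP[p0 p1]]; first by rewrite /pi big_ord0 ler01 lexx.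
  by rewrite piS; have /andP[z0 z1] := zetaC01 n x; rewrite mulr_ge0//= mulr_ile1.
have oT : open [set: X] by exact: openT.
have piC n m : smooth_order k m -> Cn_on setT m (pi n).
  move=> km; elim: n => [|n IH].
    apply: Cn_on_ext (Cn_on_cst m (1 : R) oT) => //.
    by move=> x _; rewrite /pi big_ord0.
  apply: (@Cn_on_ext _ _ _ _ _ (fun x => pi n x *: (1 + (-1) *: zeta n x))) => //.
    by move=> x _; rewrite piS scaleN1r.
  apply: Cn_onZ => //; apply: Cn_onD => //; first exact: Cn_on_cst.
  apply: (@Cn_onZ _ m _ _ setT (fun=> -1)) => //; first exact: Cn_on_cst.
  by have [/(_ m km)] := hz n.
have piL n : exists2 L : R, 0 <= L & forall x y, `|pi n x - pi n y| <= L * `|x - y|.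
  elim: n => [|n [K K0 pK]].
    by exists 0 => // x y; rewrite /pi !big_ord0 subrr normr0 mul0r.
  have [_ _ _ _ [L L0 zL]] := hz n; exists (K + L); first exact: addr_ge0.
  move=> x y; rewrite !piS.
  apply: (lipschitzM01 (f := pi n) (g := fun x => 1 - zeta n x) K0) => // x' y'.
  by rewrite opprB addrC addrA subrK distrC.
pose phi n x := zeta n x * pi n x.
have near_c n x : (\forall y \near x, zeta n y = 0) \/
    (exists2 a, E n a & `|x - a| < e n / 4).
  have [[a Ea xa]|nE] := pselect (exists2 a, E n a & `|x - a| < e n / 4).
    by right; exists a.
  left; apply/nbhs_distP; exists (e n / 8); first by rewrite divr_gt0.
  move=> y yx; have [_ _ _ z0 _] := hz n; apply: (z0 y) => a Ea.
  rewrite leNgt; apply/negP => ya; apply: nE; exists a => //.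
  by have := ler_distD y x a; rewrite (distrC x y); lra.
(* Here [3 / 8 = 1 / 4 + 1 / 8]: a point of [E n] found within [e n / 4] of [x] serves all [y]
   within [e n / 8] of [x]. Points chosen for [x] and for [y] are then less than [7 / 8 * e n]
   apart, and [Esep] gives them the same centre. *)
pose near_piece n x a := E n a /\ `|x - a| < 3 / 8 * e n.
have /choice[a ha] : forall nx : nat * X, exists a,
    (exists b, near_piece nx.1 nx.2 b) -> near_piece nx.1 nx.2 a.
  move=> [n x]; have [[b hb]|nb] := pselect (exists b, near_piece n x b).
    by exists b.
  by exists x => /nb.
exists phi, (fun n x => s (a (n, x))); split.
- move=> n m km; apply: Cn_onZ => //; last exact: piC.
  by have [/(_ m km)] := hz n.
- by move=> n x; have /andP[? _] := zeta01 n x; have /andP[? _] := pi01 n x;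
     rewrite mulr_ge0.
- move=> n; have [_ _ _ _ [L L0 zL]] := hz n; have [K K0 pK] := piL n.
  by exists (L + K); [exact: addr_ge0|exact: (lipschitzM01 (f := zeta n) (g := pi n) L0)].
- move=> x Ox; have [Osx sx _] := hs x Ox.
  have /nbhs_distP[d d0 dB] : nbhs x (ball (s x) (r (s x))).
    by apply: open_nbhs_nbhs; split=> //; exact: ball_open.
  pose N := Num.bound (`|x| + d^-1).
  have Nb : `|x| + d^-1 < N%:R.
    by rewrite archi_boundP// addr_ge0// invr_ge0 ltW.
  have ENx : E N x.
    have dV : 0 < d^-1 by rewrite invr_gt0.
    have x0 := normr_ge0 x.
    split=> //; first by apply: ltW; lra.
    move=> y yx; apply: dB; rewrite (lt_trans yx)// /e -[ltRHS]invrK.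
    by rewrite ltf_pV2 ?posrE ?ltr0n// -natr1; lra.
  exists N.+1; have [_ _ z1 _ _] := hz N.
  near=> y; have zN : zeta N y = 1 by near: y; exact: z1.
  have pi0 n : (N < n)%N -> pi n y = 0.
    by move=> Nn; rewrite /pi (bigD1 (Ordinal Nn))//= zN subrr mul0r.
  split; first by move=> n /pi0 pn; rewrite /phi pn mulr0.
  have sumE M : \sum_(i < M) phi i y = 1 - pi M y.
    elim: M => [|M IH]; first by rewrite big_ord0 /pi big_ord0 subrr.
    by rewrite big_ord_recr/= IH piS /phi; ring.
  by rewrite sumE pi0// subr0.
move=> n x; have [z0|[b Eb xb]] := near_c n x.
  by left; apply: filterS z0 => y; rewrite /phi => ->; rewrite mul0r.
right; have en := e0 n.
have np y : `|y - x| < e n / 8 -> near_piece n y (a (n, y)).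
  move=> yx; apply: (ha (n, y)); exists b; split=> //=.
  by have := ler_distD x y b; lra.
have [Ea xa] : near_piece n x (a (n, x)) by apply: np; rewrite subrr normr0 divr_gt0.
have [Oa _ aB] := Ea; have [Osa _ _] := hs _ Oa; split=> //.
apply/nbhs_distP; exists (e n / 8); first by rewrite divr_gt0.
move=> y yx; have [Eay yay] := np y yx; split.
  apply: Esep Eay Ea _.
  have := ler_distD y (a (n, y)) (a (n, x)); have := ler_distD x y (a (n, x)).
  by rewrite (distrC (a (n, y)) y); lra.
by apply: aB; have := ler_distD x y (a (n, x)); lra.
Unshelve. all: by end_near. Qed.

End PartitionOfUnity.

(** * Gluing maps along a partition of unity *)

Section Gluing.
Context {R : realType}.
Implicit Types X Y : normedModType R.

(* Junk value [0] when [u] does not vanish eventually. *)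
Definition eventual_sum Y (u : nat -> Y) : Y :=
  \sum_(i < xget 0%N [set N | forall n, (N <= n)%N -> u n = 0]) u i.

Lemma eventual_sumE Y (u : nat -> Y) N :
  (forall n, (N <= n)%N -> u n = 0) -> eventual_sum u = \sum_(i < N) u i.
Proof.
have sumE M P : (forall n, (M <= n)%N -> u n = 0) -> (M <= P)%N ->
    \sum_(i < P) u i = \sum_(i < M) u i.
  move=> uM; elim: P => [|P IH]; first by rewrite leqn0 => /eqP ->.
  rewrite leq_eqVlt => /predU1P[->//|]; rewrite ltnS => MP.
  by rewrite big_ord_recr/= uM// addr0 IH.
move=> uN; rewrite /eventual_sum; case: xgetP => [M _ /= uM|/(_ N)]//.
have [MN|/ltnW NM] := leqP M N; first by rewrite (sumE _ _ uM MN).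
by rewrite (sumE _ _ uN NM).
Qed.

(** The functions [phi] and their constants [L] are produced before [h] is given, so the pieces
    [h n a] may be chosen with errors that depend on [L n]. Near each point the centres [a i] can be
    fixed because the selected centres are locally constant. *)
Lemma smooth_gluing X Y (k : option nat) (y0 : Y) (O : set X) (r : X -> R) :
  y0 != 0 -> propLE X Y -> propLA k X Y -> (forall x, O x -> 0 < r x) ->
  exists (phi : nat -> X -> R) (L : nat -> R),
  [/\ forall n m, smooth_order k m -> Cn_on setT m (phi n),
      forall n x, 0 <= phi n x,
      forall n, 0 <= L n,
      forall n x y, `|phi n x - phi n y| <= L n * `|x - y| &
      forall h : nat -> X -> X -> Y, exists g : X -> Y, forall x, O x ->
      exists N (a : nat -> X), exists2 d : R, 0 < d &
      (forall y, `|y - x| < d -> g y = \sum_(i < N) phi i y *: h i (a i) y /\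
          \sum_(i < N) phi i y = 1) /\
      (forall i, (i < N)%N -> (forall y, `|y - x| < d -> phi i y = 0) \/
          O (a i) /\ forall y, `|y - x| < d -> ball (a i) (r (a i)) y)].
Proof.
move=> y0N0 hLE hLA r0.
have [phi [c [phiC phi0 phiL phiN phic]]] :=
  partition_of_unity y0N0 hLE hLA r0.
have /choice[L hL] : forall n, exists L : R, 0 <= L /\
    forall x y, `|phi n x - phi n y| <= L * `|x - y|.
  by move=> n; have [L L0 pL] := phiL n; exists L.
exists phi, L; split=> //; [by move=> n; have [] := hL n|
  by move=> n x y; have [_] := hL n; apply|].
move=> h; exists (fun y => eventual_sum (fun n => phi n y *: h n (c n y) y)).
move=> x Ox; have [N hN] := phiN x Ox.
have /choice[b hb] : forall i, exists b : bool, if b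
    then \forall y \near x, phi i y = 0
    else O (c i x) /\
      \forall y \near x, c i y = c i x /\ ball (c i x) (r (c i x)) y.
  by move=> i; have [z0|ci] := phic i x; [exists true|exists false].
have cells : \forall y \near x, forall i : 'I_N, if b i then phi i y = 0
    else c i y = c i x /\ ball (c i x) (r (c i x)) y.
  by apply: filter_forall => i; have := hb i; case: (b i) => // -[].
have [d d0 hd] := (nbhs_distP x _).1 (filterI hN cells).
exists N, (c ^~ x), d => //; split.
  move=> y /hd[[yN y1] yc]; split=> //.
  rewrite (@eventual_sumE _ _ N); last by move=> n /yN ->; rewrite scale0r.
  apply: eq_bigr => i _; have := yc i.
  by case: (b i) => [->|[->]]; rewrite ?scale0r.
move=> i iN; have hdi y yd := (hd y yd).2 (Ordinal iN).
case bi : (b i) (hb i) => hbi.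
  by left=> y /hdi /=; rewrite bi.
by right; split=> [|y /hdi /=]; [exact: hbi.1|rewrite bi => -[]].
Qed.

(** Since the weights sum to [1] at both points, any [w] can be subtracted from the pieces
    multiplied by [phi i y - phi i z]. The Lipschitz constants of the partition thus meet only the
    deviations of the pieces from a common value. *)
Lemma gluing_estimate X Y (N : nat) (phi : nat -> X -> R) (P : nat -> X -> Y)
    (L D : nat -> R) (T : clin X Y) (w : Y) (c : R) (y z : X) :
  (forall i, 0 <= phi i y) -> 0 <= c ->
  (forall i, 0 <= L i) -> (forall i, 0 <= D i) ->
  (forall i, `|phi i y - phi i z| <= L i * `|y - z|) ->
  \sum_(i < N) phi i y = 1 -> \sum_(i < N) phi i z = 1 ->
  (forall i, (i < N)%N -> phi i y = 0 /\ phi i z = 0 \/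
     `|P i y - P i z - T (y - z)| <= c * `|y - z| /\ `|P i z - w| <= D i) ->
  `|\sum_(i < N) phi i y *: P i y - \sum_(i < N) phi i z *: P i z - T (y - z)|
    <= (c + \sum_(i < N) L i * D i) * `|y - z|.
Proof.
move=> phi0 c0 L0 D0 phiL sy sz hP.
have -> : \sum_(i < N) phi i y *: P i y - \sum_(i < N) phi i z *: P i z - T (y - z)
  = \sum_(i < N) (phi i y *: (P i y - P i z - T (y - z)) +
                  (phi i y - phi i z) *: (P i z - w)).
  transitivity (\sum_(i < N) (phi i y *: P i y - phi i z *: P i z -
    phi i y *: T (y - z) - (phi i y - phi i z) *: w)).
    by rewrite !sumrB -!scaler_suml sumrB sy sz subrr scale0r subr0 scale1r.
  apply: eq_bigr => i _; rewrite !scalerBr (scalerBl _ _ (P i z)).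
  by rewrite [RHS]addrA; congr (_ - _); rewrite [RHS]addrAC addrA subrK.
rewrite mulrDl -[c]mulr1 -sy mulr_sumr !mulr_suml -big_split/=.
rewrite (le_trans (ler_norm_sum _ _ _))//; apply: ler_sum => i _.
have [[-> ->]|[h1 h2]] := hP i (ltn_ord i).
  rewrite subrr !scale0r addr0 normr0 mulr0 mul0r add0r.
  by rewrite !mulr_ge0.
rewrite (le_trans (ler_normD _ _))// !normrZ (ger0_norm (phi0 i)) lerD//.
  by rewrite [c * _]mulrC -[leRHS]mulrA ler_wpM2l.
by rewrite [leRHS]mulrAC ler_pM.
Qed.

End Gluing.

(** * Extensions of [f] with prescribed accuracy of the strict derivative *)

Section LocalExtension.
Context {R : realType}.
Variables (X Y : normedModType R).

(** With [T = 0] this is a local Lipschitz condition; if it holds for every [e > 0], then [T] is the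
    strict derivative at [x]. *)
Definition lip_near (q : X -> Y) (x : X) (T : clin X Y) (e : R) : Prop :=
  exists2 d : R, 0 < d & forall y z, `|y - x| < d -> `|z - x| < d ->
    `|q y - q z - T (y - z)| <= e * `|y - z|.

Lemma clinB (T : clin X Y) u v : T (u - v) = T u - T v.
Proof. exact: linearB. Qed.

Variables (k : option nat) (y0 : Y).
Hypotheses (y0N0 : y0 != 0) (hLE : propLE X Y) (hLA : propLA k X Y).
Variables (Omega A : set X).
Hypotheses (hA : A `<=` Omega).
Hypothesis hAcl : exists2 F : set X, closed F & A = Omega `&` F.
Variables (f : X -> Y) (G : X -> clin X Y).
Hypothesis hW : condW A f G.

Lemma condW_continuous a e : A a -> 0 < e -> exists2 d : R, 0 < d &
  forall b, A b -> `|b - a| < d -> `|G b - G a| <= e.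
Proof.
move=> Aa e0; have [/subspace_continuousP/(_ a Aa)/cvgrPdist_le Gc _] := hW.
have /nbhs_distP[d d0 hd] := Gc e e0; exists d => // b Ab ba.
by rewrite distrC; exact: hd ba Ab.
Qed.

Lemma relatively_closed_dist x : Omega x -> ~ A x ->
  exists2 d : R, 0 < d & forall a, A a -> d <= `|a - x|.
Proof.
move=> Ox nAx; have [F Fcl AE] := hAcl.
have Fx : (~` F) x by move=> Fx; apply: nAx; rewrite AE.
have /nbhs_distP[d d0 hd] : nbhs x (~` F).
  by apply: open_nbhs_nbhs; split=> //; exact: closed_openC.
exists d => // a Aa; rewrite leNgt; apply/negP => /hd; apply.
by move: Aa; rewrite AE => -[].
Qed.

Lemma extension_approx (e : R) : 0 < e -> exists q : X -> Y,
  [/\ forall b, A b -> q b = f b,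
      forall b, A b -> lip_near q b (G b) e &
      forall x, Omega x -> exists K, lip_near q x 0 K].
Proof.
move=> e0; have [C C0 LE] := propLE_ext hLE.
(* On a cell the piece minus [G b] has constant [C * eta] from (LE) plus [eta] from the oscillation
   of [G]; the partition may contribute as much again, hence the factor [2]. *)
pose eta := e / (2 * (C + 1)).
have C10 : 0 < C + 1 by rewrite addr_gt0.
have eta0 : 0 < eta by rewrite divr_gt0// mulr_gt0.
(* Each point receives a piece, a radius and a Lipschitz constant. The last clause keeps balls
   centred off [A] away from [A], so a cell that contains a point of [A] has its centre in [A]. *)
have /choice[D hD] : forall x, exists D : (X -> Y) * R * R,
    let: (h, r, K) := D in
    [/\ 0 < r, 0 <= K, forall y z, `|h y - h z| <= K * `|y - z|,
      A x -> (forall y, A y -> `|y - x| < r -> h y = f y /\ `|G y - G x| <= eta) /\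
        forall y z, `|h y - h z - G x (y - z)| <= C * eta * `|y - z| &
      Omega x -> ~ A x -> forall y, A y -> r <= `|y - x|].
  move=> x; have [Ax|nAx] := pselect (A x); last first.
    have [Ox|nOx] := pselect (Omega x); last first.
      exists (cst 0, 1, 0); split=> //.
      by move=> y z; rewrite subrr normr0 mul0r.
    have [d d0 hd] := relatively_closed_dist Ox nAx.
    exists (cst 0, d, 0); split=> // y z.
    by rewrite subrr normr0 mul0r.
  have [d1 d10 h1] := condW_continuous Ax eta0.
  have [_ /(_ x Ax eta eta0)[d2 d20 h2]] := hW.
  pose r := Num.min d1 d2; have r0 : 0 < r by rewrite lt_min d10.
  have [||h hL hf] := LE (A `&` ball x r) eta (fun y => f y - G x y).
  - exact: ltW.
  - move=> y z [Ay By] [Az Bz].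
    have -> : f y - G x y - (f z - G x z) = f y - f z - G x (y - z).
      rewrite clinB !opprB [LHS]addrACA [RHS]addrACA; congr (_ + _).
      exact: addrC.
    apply: h2; split=> //; [move: Bz|move: By]; apply: le_ball.
      by rewrite /r ge_min lexx orbT.
    by rewrite /r ge_min lexx orbT.
  exists (fun y => h y + G x y, r, C * eta + `|G x|).
  have E y z : h y + G x y - (h z + G x z) = h y - h z + G x (y - z).
    by rewrite opprD addrACA clinB.
  split=> //.
  - by rewrite addr_ge0// mulr_ge0// ltW.
  - move=> y z; rewrite E mulrDl (le_trans (ler_normD _ _))// lerD//.
    exact: clin_norm.
  - move=> _; split; last by move=> y z; rewrite E addrK.
    move=> y Ay yx; rewrite hf ?subrK; last first.
      by split=> //; rewrite ball_distE.
    by split=> //; apply: h1 => //; rewrite (lt_le_trans yx)// /r ge_min lexx.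
pose h x := (D x).1.1; pose r x := (D x).1.2; pose K x := (D x).2.
have {}hD x : [/\ 0 < r x, 0 <= K x, forall y z, `|h x y - h x z| <= K x * `|y - z|,
    A x -> (forall y, A y -> `|y - x| < r x -> h x y = f y /\ `|G y - G x| <= eta) /\
      forall y z, `|h x y - h x z - G x (y - z)| <= C * eta * `|y - z| &
    Omega x -> ~ A x -> forall y, A y -> r x <= `|y - x|].
  by have := hD x; rewrite /h /r /K; case: (D x) => -[].
have r0 x : Omega x -> 0 < r x by have [] := hD x.
have [phi [L [_ phi0 L0 phiL glue]]] := smooth_gluing y0N0 hLE hLA r0.
have [q hq] := glue (fun _ => h); exists q; split.
- move=> b Ab; have [N [a [d d0 [hd ha]]]] := hq b (hA Ab).
  have [|-> s1] := hd b; first by rewrite subrr normr0.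
  rewrite -[RHS]scale1r -s1 scaler_suml; apply: eq_bigr => i _.
  have [->|[Oa hai]] := ha i (ltn_ord i); rewrite ?subrr ?normr0 ?scale0r//.
  have := hai b; rewrite subrr normr0 ball_distE => /(_ d0) ba.
  have [_ _ _ hAi hnA] := hD (a i).
  have [/hAi[/(_ b Ab ba)[-> _]]//|nA] := pselect (A (a i)).
  by have := hnA Oa nA b Ab; rewrite leNgt ba.
- move=> b Ab; have [N [a [d d0 [hd ha]]]] := hq b (hA Ab).
  pose S := \sum_(i < N) L i; have S0 : 0 <= S by exact: sumr_ge0.
  (* All pieces agree with [f] at [b], hence stay within [(C + 1) * eta * |z - b|] of
     [f b + G b (z - b)]. The second radius makes [S * |z - b| <= 1], which cancels the Lipschitz
     constants of the partition. *)
  pose d' := Num.min d (S + 1)^-1.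
  have S10 : 0 < (S + 1)^-1 by rewrite invr_gt0 ltr_wpDl.
  exists d'; first by rewrite lt_min d0.
  move=> y z; rewrite !lt_min => /andP[yd _] /andP[zd zS].
  have [-> sy] := hd y yd; have [-> sz] := hd z zd.
  have Ce0 : 0 <= (C + 1) * eta by rewrite mulr_ge0// ltW.
  have := @gluing_estimate _ _ _ N phi (fun i => h (a i)) L
    (fun=> (C + 1) * eta * `|z - b|) (G b) (f b + G b (z - b)) ((C + 1) * eta)
    y z (fun i => phi0 i y) Ce0 L0 (fun=> mulr_ge0 Ce0 (normr_ge0 _))
    (fun i => phiL i y z) sy sz.
  move=> /(_ _)/le_trans; apply.
    move=> i iN; have [p0|[Oa hai]] := ha i iN; first by left; rewrite !p0.
    right; have := hai b; rewrite subrr normr0 ball_distE => /(_ d0) ba.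
    have [_ _ _ hAi hnA] := hD (a i).
    have [/hAi[/(_ b Ab ba)[hb Gb] hL]|nA] := pselect (A (a i)); last first.
      by have := hnA Oa nA b Ab; rewrite leNgt ba.
    have hG y' z' : `|h (a i) y' - h (a i) z' - G b (y' - z')| <=
        (C + 1) * eta * `|y' - z'|.
      have -> : h (a i) y' - h (a i) z' - G b (y' - z') =
         h (a i) y' - h (a i) z' - G (a i) (y' - z') - (G b - G (a i)) (y' - z').
        by rewrite clinD -/(- G (a i) (y' - z')) [in RHS]opprB addrA subrK.
      rewrite (le_trans (ler_normB _ _))// mulrDl mul1r mulrDl lerD ?hL//.
      by rewrite (le_trans (clin_norm _ _))// ler_wpM2r.
    by split; [exact: hG|rewrite -hb opprD addrA; exact: hG].
  rewrite ler_wpM2r// -mulr_suml.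
  have Sz : S * `|z - b| <= 1.
    rewrite mulrC; have : `|z - b| * (S + 1) <= 1.
      by rewrite -ler_pdivlMr ?ltr_wpDl// div1r ltW.
    by apply: le_trans; rewrite ler_wpM2l// lerDl.
  have eE : e = (C + 1) * eta + (C + 1) * eta.
    by rewrite /eta; field; rewrite gt_eqF.
  by rewrite {}eE lerD2l -/S mulrCA ler_piMr.
move=> x Ox; have [N [a [d d0 [hd ha]]]] := hq x Ox.
pose c := \sum_(i < N) K (a i).
have K0 y : 0 <= K y by have [] := hD y.
have Kc i : (i < N)%N -> K (a i) <= c.
  move=> iN; rewrite /c (bigD1 (Ordinal iN))//= lerDl sumr_ge0//.
have c0 : 0 <= c by exact: sumr_ge0.
pose B i := `|h (a i) x| + K (a i) * d.
have B0 i : 0 <= B i by rewrite addr_ge0// mulr_ge0// ltW.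
exists (c + \sum_(i < N) L i * B i), d => // y z yd zd.
have [-> sy] := hd y yd; have [-> sz] := hd z zd.
apply: (@gluing_estimate _ _ _ N phi (fun i => h (a i)) L B 0 0 c y z) => //.
move=> i iN; right; have [_ _ hK _ _] := hD (a i); rewrite clin0 !subr0; split.
  by rewrite (le_trans (hK _ _))// ler_wpM2r// Kc.
rewrite -[h _ z](subrKC (h (a i) x)) (le_trans (ler_normD _ _))// lerD2l.
by rewrite (le_trans (hK _ _))// ler_wpM2l// ltW.
Qed.

End LocalExtension.

(** * Distance to [A], depth in a union of balls, and a scale-free cutoff *)

Section DistanceDepth.
Context {R : realType} {X : normedModType R}.
Variable A : set X.
Hypothesis A0 : A !=set0.

Definition set_dist (x : X) : R := inf [set `|x - a| | a in A].

Lemma set_dist_le x a : A a -> set_dist x <= `|x - a|.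
Proof.
by move=> Aa; apply: ge_inf; [exists 0 => _ [b _ <-]|exists a].
Qed.

Lemma set_dist_ge x (t : R) : (forall a, A a -> t <= `|x - a|) -> t <= set_dist x.
Proof.
move=> h; apply: lb_le_inf; first by have [a Aa] := A0; exists `|x - a|, a.
by move=> _ [a Aa <-]; exact: h.
Qed.

Lemma set_dist_lt x (t : R) : set_dist x < t -> exists2 a, A a & `|x - a| < t.
Proof.
move=> h; have [//|nE] := pselect (exists2 a, A a & `|x - a| < t).
exfalso; move: h; apply/negP; rewrite -leNgt; apply: set_dist_ge => a Aa.
by rewrite leNgt; apply/negP => xa; apply: nE; exists a.
Qed.

Lemma set_distD x y : set_dist x <= set_dist y + `|x - y|.
Proof.
rewrite -lerBlDr; apply: set_dist_ge => a Aa; rewrite lerBlDr.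
by have := set_dist_le x Aa; have := ler_distD y x a; lra.
Qed.

(* The depth of [x] in the union of the balls [ball b (rho b)]. *)
Definition depth (rho : X -> R) (x : X) : R :=
  sup [set Num.max 0 (rho b - `|x - b|) | b in A].

Variables (rho : X -> R) (c : R).
Hypotheses (c0 : 0 <= c) (rhoc : forall b, A b -> rho b <= c).

Lemma depth_ub x : ubound [set Num.max 0 (rho b - `|x - b|) | b in A] c.
Proof.
move=> _ [b Ab <-]; rewrite ge_max c0/=.
by rewrite lerBlDr (le_trans (rhoc Ab))// lerDl.
Qed.

Lemma depth_le x : depth rho x <= c.
Proof.
apply: ge_sup; last exact: depth_ub.
by have [a Aa] := A0; exists (Num.max 0 (rho a - `|x - a|)), a.
Qed.

Lemma depth_ge_max x b : A b -> Num.max 0 (rho b - `|x - b|) <= depth rho x.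
Proof.
by move=> Ab; apply: ub_le_sup; [exists c; exact: depth_ub|exists b].
Qed.

Lemma depth_ge x b : A b -> rho b - `|x - b| <= depth rho x.
Proof.
by move=> Ab; rewrite (le_trans _ (depth_ge_max x Ab))// le_max lexx orbT.
Qed.

Lemma depth_gt x (t : R) : 0 <= t -> t < depth rho x ->
  exists2 b, A b & t < rho b - `|x - b|.
Proof.
move=> t0 h; have [//|nE] := pselect (exists2 b, A b & t < rho b - `|x - b|).
exfalso; move: h; apply/negP; rewrite -leNgt; apply: ge_sup.
  by have [a Aa] := A0; exists (Num.max 0 (rho a - `|x - a|)), a.
move=> _ [b Ab <-]; rewrite ge_max t0/= leNgt; apply/negP => tb.
by apply: nE; exists b.
Qed.

Lemma depthD x y : depth rho x <= depth rho y + `|x - y|.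
Proof.
apply: ge_sup; first by have [a Aa] := A0; exists (Num.max 0 (rho a - `|x - a|)), a.
move=> _ [b Ab <-]; have := depth_ge_max y Ab; rewrite !ge_max => /andP[h1 h2].
rewrite addr_ge0//=; have := ler_distD x y b; rewrite (distrC y x); lra.
Qed.

End DistanceDepth.

(** It is applied to a depth [e] and the distance [d] to [A], both 1-Lipschitz. The slope of their
    ratio, truncated to this range, is of order [1 / d] however small and irregular the balls
    defining the depth are. *)
Definition ratio_cutoff {R : realType} (e d : R) : R :=
  Num.max 0 (Num.min 1 (e / d - 1)).

Section RatioCutoff.
Context {R : realType}.
Implicit Types e d : R.

Lemma ratio_cutoff01 e d : 0 <= ratio_cutoff e d <= 1.
Proof. by rewrite /ratio_cutoff le_max lexx /= ge_max ler01 ge_min lexx. Qed.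

Lemma ratio_cutoff_gt0 e d : 0 < d -> 0 < ratio_cutoff e d ->
  (ratio_cutoff e d + 1) * d <= e.
Proof.
move=> d0 h; rewrite -ler_pdivlMr// -lerBrDr; move: h.
rewrite /ratio_cutoff lt_max ltxx/= => h.
by rewrite ge_max ltW//=; [rewrite ge_min lexx orbT|move: h; rewrite lt_min => /andP[]].
Qed.

Lemma ratio_cutoff_lt1 e d : 0 < d -> ratio_cutoff e d < 1 ->
  e <= (ratio_cutoff e d + 1) * d.
Proof.
move=> d0 h; rewrite -ler_pdivrMr// -lerBlDr; move: h.
rewrite /ratio_cutoff gt_max gt_min ltxx/= => /andP[_ h].
by rewrite le_max le_min lexx (ltW h) !orbT.
Qed.

Lemma ratio_cutoff_eq1 e d : 0 < d -> 2 * d <= e -> ratio_cutoff e d = 1.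
Proof.
move=> d0 h; have /andP[_] := ratio_cutoff01 e d; rewrite le_eqVlt.
move=> /predU1P[//|/[dup] lt1 /(ratio_cutoff_lt1 d0)]; nra.
Qed.

Lemma ratio_cutoff_eq0 e d : 0 < d -> e <= d -> ratio_cutoff e d = 0.
Proof.
move=> d0 h; have /andP[] := ratio_cutoff01 e d; rewrite le_eqVlt.
move=> /predU1P[//|/[dup] gt0 /(ratio_cutoff_gt0 d0)]; nra.
Qed.

(** If the two values differ, the larger is positive and the smaller is below [1], so both
    truncations turn into linear inequalities. Comparing them costs [N] for the change of [e] and at
    most [2 * N] for the change of [d], since cutoff plus one is at most [2]. *)
Lemma ratio_cutoff_lipschitz e d e' d' (N : R) : 0 < d -> 0 < d' ->
  `|e - e'| <= N -> `|d - d'| <= N ->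
  `|ratio_cutoff e d - ratio_cutoff e' d'| * d' <= 3 * N.
Proof.
move=> d0 d'0; rewrite !ler_norml => /andP[e1 e2] /andP[d1 d2].
have /andP[p0 p1] := ratio_cutoff01 e d.
have /andP[s0 s1] := ratio_cutoff01 e' d'.
have := ratio_cutoff_gt0 (e := e) d0; have := ratio_cutoff_lt1 (e := e) d0.
have := ratio_cutoff_gt0 (e := e') d'0; have := ratio_cutoff_lt1 (e := e') d'0.
move: (ratio_cutoff e d) (ratio_cutoff e' d') p0 p1 s0 s1 => p s p0 p1 s0 s1.
have N0 : 0 <= N by lra.
have [ps|ps|->] := ltgtP p s.
- move=> _ /(_ (le_lt_trans p0 ps)) h1 /(_ (lt_le_trans ps s1)) h2 _.
  by rewrite ltr0_norm ?subr_lt0//; nra.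
- move=> /(_ (lt_le_trans ps p1)) h1 _ _ /(_ (le_lt_trans s0 ps)) h2.
  by rewrite gtr0_norm ?subr_gt0//; nra.
by move=> *; rewrite subrr normr0 mul0r mulr_ge0.
Qed.

End RatioCutoff.

(** * The telescoping series and its behaviour near [A] *)

Section StrictExtension.
Context {R : realType}.
Variables (X Y : normedModType R) (k : option nat) (y0 : Y).
Hypotheses (y0N0 : y0 != 0) (hLE : propLE X Y) (hLA : propLA k X Y).
Variables (Omega A : set X).
Hypotheses (hA : A `<=` Omega).
Hypothesis hAcl : exists2 F : set X, closed F & A = Omega `&` F.
Variables (f : X -> Y) (G : X -> clin X Y).
Hypothesis hW : condW A f G.

Let eps (n : nat) : R := 2^-1 ^+ n.

Let eps0 n : 0 < eps n.
Proof. by rewrite exprn_gt0// invr_gt0. Qed.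

Let epsS n : eps n = 2 * eps n.+1.
Proof. by rewrite /eps exprS mulrA divff// mul1r. Qed.

Lemma half_pow_small (e : R) : 0 < e -> exists n, eps n <= e.
Proof.
move=> e0; exists (Num.bound e^-1).
have b : e^-1 < (Num.bound e^-1)%:R by rewrite archi_boundP// invr_ge0 ltW.
rewrite /eps exprVn -[leRHS]invrK lef_pV2 ?posrE ?invr_gt0 ?exprn_gt0//.
by rewrite (le_trans (ltW b))// -natrX ler_nat ltnW// ltn_expl.
Qed.

Let eps_anti n m : (n <= m)%N -> eps m <= eps n.
Proof.
move=> nm; rewrite /eps ler_wiXn2l ?invr_ge0//.
by rewrite invf_le1 ?ler1n.
Qed.

Lemma strict_extension : exists ft : X -> Y,
  [/\ forall a, A a -> ft a = f a,
      forall a e, A a -> 0 < e -> exists2 d : R, 0 < d &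
        forall x, Omega x -> ~ A x -> `|x - a| < d ->
          `|ft x - f a - G a (x - a)| <= e * `|x - a| /\ lip_near ft x (G a) e &
      forall x, Omega x -> ~ A x -> exists K, lip_near ft x 0 K].
Proof.
have [A0|nA0] := pselect (A !=set0); last first.
  exists (cst 0); split=> [a Aa|a e Aa|x _ _]; try by case: nA0; exists a.
  by exists 0, 1 => // y z _ _; rewrite subrr clin0 subr0 normr0 mul0r.
have /choice[q hq] : forall n, exists q : X -> Y,
    [/\ forall b, A b -> q b = f b, forall b, A b -> lip_near q b (G b) (eps n) &
      forall x, Omega x -> exists K, lip_near q x 0 K].
  by move=> n; exact: (extension_approx y0N0 hLE hLA hA hAcl hW (eps0 n)).
have /choice[r hr] : forall nb : nat * X, exists r : R, 0 < r /\
    (A nb.2 -> forall y z, `|y - nb.2| < r -> `|z - nb.2| < r ->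
      `|q nb.1 y - q nb.1 z - G nb.2 (y - z)| <= eps nb.1 * `|y - z|).
  move=> [n b]; have [Ab|nA] := pselect (A b); last by exists 1; split.
  by have [_ /(_ b Ab)[d d0 hd] _] := hq n; exists d.
(* The radii decrease with [n], so within [rho m b] of [b] every [q n] with [n <= m] is controlled.
   The bound by [eps n] makes [psi n] vanish at distance at least [eps n] from [A], so the series is
   locally finite off [A]. *)
pose rho := fix rho (n : nat) (b : X) : R :=
  if n is m.+1 then Num.min (rho m b) (Num.min (r (n, b)) (eps n))
  else Num.min (r (0%N, b)) (eps 0).
have rhoE0 b : rho 0%N b = Num.min (r (0%N, b)) (eps 0) by [].
have rhoES n b : rho n.+1 b = Num.min (rho n b) (Num.min (r (n.+1, b)) (eps n.+1)).
  by [].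
have rpos nb : 0 < r nb by have [] := hr nb.
move: rho rhoE0 rhoES => rho rhoE0 rhoES.
have rho_anti b n m : (n <= m)%N -> rho m b <= rho n b.
  elim: m => [|m IH]; first by rewrite leqn0 => /eqP ->.
  rewrite leq_eqVlt => /predU1P[->//|]; rewrite ltnS => /IH.
  by apply: le_trans; rewrite rhoES ge_min lexx.
have rho0 n b : 0 < rho n b.
  elim: n => [|n IH]; first by rewrite rhoE0 lt_min rpos eps0.
  by rewrite rhoES !lt_min IH rpos eps0.
have rhor n b : rho n b <= r (n, b).
  by case: n => [|n]; rewrite (rhoE0, rhoES) !ge_min lexx ?orbT.
have rhoeps n b : rho n b <= eps n.
  by case: n => [|n]; rewrite (rhoE0, rhoES) !ge_min lexx ?orbT.
have qlip n m b y z : A b -> (n <= m)%N -> `|y - b| < rho m b -> `|z - b| < rho m b ->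
    `|q n y - q n z - G b (y - z)| <= eps n * `|y - z|.
  move=> Ab nm yb zb; have [_ h] := hr (n, b).
  have mr : rho m b <= r (n, b) by rewrite (le_trans (rho_anti b _ _ nm)).
  by apply: h => //=; [exact: lt_le_trans yb mr|exact: lt_le_trans zb mr].
pose dA := set_dist A; pose dl n := depth A (rho n).
pose psi n x := ratio_cutoff (dl n x) (dA x).
pose E n x := q n.+1 x - q n x.
pose w n x := psi n.+1 x *: E n x.
have psi0 n x : 0 <= psi n x by have /andP[] := ratio_cutoff01 (dl n x) (dA x).
have psi1 n x : psi n x <= 1 by have /andP[] := ratio_cutoff01 (dl n x) (dA x).
have EA n a : A a -> E n a = 0.
  move=> Aa; have [qa _ _] := hq n; have [qa' _ _] := hq n.+1.
  by rewrite /E qa// qa'// subrr.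
have Elip n b y z : A b -> `|y - b| < rho n.+1 b -> `|z - b| < rho n.+1 b ->
    `|E n y - E n z| <= 2 * eps n * `|y - z|.
  move=> Ab yb zb; have h1 := qlip _ _ _ _ _ Ab (leqnn n.+1) yb zb.
  have h2 := qlip _ _ _ _ _ Ab (leqnSn n) yb zb.
  have -> : E n y - E n z = q n.+1 y - q n.+1 z - G b (y - z) -
      (q n y - q n z - G b (y - z)).
    rewrite (opprB _ (G b _)) [RHS]addrA subrK /E !opprB.
    by rewrite [LHS]addrACA [RHS]addrACA; congr (_ + _); exact: addrC.
  rewrite (le_trans (ler_normB _ _))// (le_trans (lerD h1 h2))// -mulrDl.
  by rewrite ler_wpM2r//; have := epsS n; have := eps0 n.+1; lra.
(* Where [psi n] is positive the depth exceeds the distance to [A], so a single ball contains [x]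
   together with almost nearest points of [A]. *)
have active n x : 0 < dA x -> 0 < psi n x ->
    exists b, [/\ A b, dA x < rho n b - `|x - b| & `|x - b| < rho n b].
  move=> dx px; have h := ratio_cutoff_gt0 dx px.
  have [||b Ab hb] := @depth_gt _ _ A A0 (rho n) x (dA x).
  - exact: ltW.
  - by apply: lt_le_trans h; rewrite ltr_pMl// ltrDr.
  by exists b; split=> //; rewrite -subr_gt0 (lt_trans dx).
have dAle x a : A a -> dA x <= `|x - a| by exact: set_dist_le.
have dAD x y : `|dA x - dA y| <= `|x - y|.
  have := set_distD A0 x y; have := set_distD A0 y x; rewrite (distrC y) -/dA => h1 h2.
  by rewrite ler_norml; apply/andP; split; lra.
have rhoc n b : A b -> rho n b <= eps n by [].
have dlD n x y : `|dl n x - dl n y| <= `|x - y|.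
  have dlS u v : dl n u <= dl n v + `|u - v|.
    exact: (depthD A0 (ltW (eps0 n)) (rhoc n)).
  by have := dlS x y; have := dlS y x; rewrite ler_norml (distrC y); lra.
(* [E n] vanishes on [A] and is [2 * eps n]-Lipschitz on the ball found by [active]; comparison with
   a point of [A] at distance below [2 * dA x] gives the factor [4]. *)
have Esmall n x : 0 < dA x -> 0 < psi n.+1 x -> `|E n x| <= 4 * eps n * dA x.
  move=> dx px; have [b [Ab hb xb]] := active _ _ dx px.
  have [|a Aa] := @set_dist_lt _ _ A A0 x (Num.min (2 * dA x) (rho n.+1 b - `|x - b|)).
    by rewrite lt_min hb andbT ltr_pMl// ltr1n.
  rewrite lt_min => /andP[a1 a2].
  have ab : `|a - b| < rho n.+1 b.
    by have := ler_distD x a b; rewrite (distrC a x); lra.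
  have := Elip n b x a Ab xb ab; rewrite (EA n a Aa) subr0 => /le_trans; apply.
  rewrite (_ : 4 * eps n * dA x = 2 * eps n * (2 * dA x)); last by ring.
  by rewrite ler_wpM2l ?mulr_ge0 ?(ltW (eps0 _))// ltW.
have wsmall n x : 0 < dA x -> `|w n x| <= 4 * eps n * dA x.
  move=> dx; have := psi0 n.+1 x; rewrite le_eqVlt => /predU1P[p0|p0].
    by rewrite /w -p0 scale0r normr0 !mulr_ge0// ltW.
  rewrite normrZ ger0_norm// (le_trans _ (Esmall n x dx p0))//.
  by rewrite ler_piMl.
(* The constant is [14 = 2 + 3 * 4]: the Lipschitz constant of [E n], plus the cutoff slope [3 / dA]
   times the size [4 * eps n * dA] of [E n]. The distance cancels, so the bound does not degenerate
   near [A]. *)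
have wlip n x y z : 0 < dA x -> `|y - x| < dA x / 4 -> `|z - x| < dA x / 4 ->
    `|w n y - w n z| <= 14 * eps n * `|y - z|.
  move=> dx.
  suff wlog_z y' z' : `|y' - x| < dA x / 4 -> `|z' - x| < dA x / 4 ->
      0 < psi n.+1 z' -> `|w n y' - w n z'| <= 14 * eps n * `|y' - z'|.
    move=> yx zx; have := psi0 n.+1 z; rewrite le_eqVlt => /predU1P[pz|pz]; last first.
      exact: wlog_z.
    have := psi0 n.+1 y; rewrite le_eqVlt => /predU1P[py|py]; last first.
      by rewrite distrC (distrC y); exact: wlog_z.
    by rewrite /w -pz -py !scale0r subrr normr0 !mulr_ge0// ltW.
  move=> yx zx pz.
  have dnear u : `|u - x| < dA x / 4 -> 0 < dA u /\ 3 / 4 * dA x <= dA u.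
    by have := dAD u x; rewrite ler_norml => /andP[]; lra.
  have [dy _] := dnear y' yx; have [dz dz4] := dnear z' zx.
  have [b [Ab hb zb]] := active _ _ dz pz.
  have yb : `|y' - b| < rho n.+1 b.
    have := ler_distD z' y' b; have := ler_distD x y' z'.
    by rewrite (distrC x z'); lra.
  have -> : w n y' - w n z' =
      psi n.+1 y' *: (E n y' - E n z') + (psi n.+1 y' - psi n.+1 z') *: E n z'.
    by rewrite scalerBr scalerBl addrA subrK.
  rewrite (le_trans (ler_normD _ _))// !normrZ (ger0_norm (psi0 _ _)).
  have t1 : psi n.+1 y' * `|E n y' - E n z'| <= 2 * eps n * `|y' - z'|.
    by rewrite (le_trans _ (Elip n b y' z' Ab yb zb))// ler_piMl.
  have t2 : `|psi n.+1 y' - psi n.+1 z'| * `|E n z'| <= 12 * eps n * `|y' - z'|.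
    rewrite (@le_trans _ _ (`|psi n.+1 y' - psi n.+1 z'| * (4 * eps n * dA z')))//.
      by rewrite ler_wpM2l// Esmall.
    have := ratio_cutoff_lipschitz dy dz (dlD n.+1 y' z') (dAD y' z').
    rewrite -/(psi n.+1 y') -/(psi n.+1 z') => h.
    rewrite mulrCA (_ : 12 * _ * _ = 4 * eps n * (3 * `|y' - z'|)); last by ring.
    by rewrite ler_wpM2l// mulr_ge0// ltW.
  by rewrite (_ : 14 * _ * _ = 2 * eps n * `|y' - z'| + 12 * eps n * `|y' - z'|);
    [rewrite lerD|ring].
pose F n x := q 0%N x + \sum_(i < n) w i x.
have FS n x : F n.+1 x = F n x + w n x by rewrite /F big_ord_recr/= addrA.
pose ft x := if x \in A then f x else q 0%N x + eventual_sum (w ^~ x).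
have ftE n x : 0 < dA x -> eps n <= dA x -> forall m, (n <= m)%N -> ft x = F m x.
  move=> dx nx m nm; rewrite /ft memNset; last first.
    by move=> Ax; have := dAle x x Ax; rewrite subrr normr0 leNgt dx.
  rewrite /F (@eventual_sumE _ _ _ m)// => i mi; rewrite /w /psi.
  rewrite ratio_cutoff_eq0 ?scale0r//.
  rewrite (le_trans (depth_le A0 (ltW (eps0 i.+1)) (rhoc i.+1) x))//.
  by rewrite (le_trans _ nx)// eps_anti// (leq_trans nm)// ltnW.
(* The partial sum telescopes where its cutoffs equal [1]; this is how [ft] inherits the accuracy of
   [q m] near a point of [A]. *)
have Fq m x : (forall n, (0 < n <= m)%N -> psi n x = 1) -> F m x = q m x.
  elim: m => [|m IH] p1; first by rewrite /F big_ord0 addr0.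
  rewrite FS IH => [|n /andP[n0 nm]]; last by apply: p1; rewrite n0 leqW.
  by rewrite /w p1 ?leqnn// scale1r /E addrC subrK.
(* The terms from [m] on add at most [14 * (eps m + eps (m + 1) + ...) = 28 * eps m]. *)
have ft_lip m x (T : clin X Y) (c d : R) : 0 < d -> 0 < dA x ->
    (forall y z, `|y - x| < d -> `|z - x| < d ->
       `|F m y - F m z - T (y - z)| <= c * `|y - z|) ->
    lip_near ft x T (c + 28 * eps m).
  move=> d0 dx hF.
  have [M hM] : exists M, eps M <= 3 / 4 * dA x by apply: half_pow_small; lra.
  exists (Num.min d (dA x / 4)); first by rewrite lt_min d0/=; lra.
  move=> y z; rewrite !lt_min => /andP[yd yx] /andP[zd zx].
  have := dAD y x; have := dAD z x; rewrite !ler_norml => /andP[z1 z2] /andP[y1 y2].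
  have dy : 0 < dA y by lra.
  have dz : 0 < dA z by lra.
  rewrite (ftE M y dy _ (m + M)%N (leq_addl _ _)); last by lra.
  rewrite (ftE M z dz _ (m + M)%N (leq_addl _ _)); last by lra.
  apply: (@le_trans _ _ ((c + 28 * (eps m - eps (m + M))) * `|y - z|)); last first.
    by rewrite ler_wpM2r//; have := eps0 (m + M); lra.
  elim: M {hM} => [|M IH]; first by rewrite addn0 subrr mulr0 addr0 hF.
  rewrite addnS !FS.
  have -> : F (m + M)%N y + w (m + M)%N y - (F (m + M)%N z + w (m + M)%N z) - T (y - z)
    = F (m + M)%N y - F (m + M)%N z - T (y - z) + (w (m + M)%N y - w (m + M)%N z).
    by rewrite opprD (addrACA (F _ y)) [LHS]addrAC.
  rewrite (le_trans (ler_normD _ _))// (le_trans (lerD IH (wlip _ x y z dx yx zx)))//.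
  by rewrite -mulrDl ler_wpM2r//; have := epsS (m + M); lra.
have Opos x : Omega x -> ~ A x -> 0 < dA x.
  move=> Ox nAx; have [d d0 hd] := relatively_closed_dist hAcl Ox nAx.
  apply: (lt_le_trans d0); apply: set_dist_ge => // a /hd; by rewrite distrC.
exists ft; split.
- by move=> a Aa; rewrite /ft mem_set.
- move=> a e Aa e0.
  (* Here [29 = 1 + 28], one for [q m] and [28] for the tail; the estimate of values needs only
     [1 + 8]. *)
  have [m hm] : exists m, eps m <= e / 29 by apply: half_pow_small; rewrite divr_gt0.
  (* Closer than [rho m a / 3] to [a], the depth exceeds [2 / 3 * rho m a], hence twice the distance
     to [A], so the cutoffs [psi n] with [0 < n <= m] equal [1]. *)
  exists (rho m a / 3); first by rewrite divr_gt0.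
  move=> x Ox nAx xa; have dx := Opos x Ox nAx; have ra := rho0 m a.
  have p1 y n : 0 < dA y -> `|y - a| < rho m a / 3 -> (0 < n <= m)%N -> psi n y = 1.
    move=> dy ya /andP[_ nm]; apply: ratio_cutoff_eq1 => //.
    have := depth_ge (ltW (eps0 n)) (rhoc n) y Aa; have := dAle y a Aa.
    by have := rho_anti a n m nm; rewrite /dl; lra.
  have aa : `|a - a| < rho m a by rewrite subrr normr0.
  split.
    have [M hM] := half_pow_small dx.
    rewrite (ftE M x dx hM (m + M)%N (leq_addl _ _)).
    have FqM P : `|F (m + P)%N x - q m x| <= 8 * (eps m - eps (m + P)) * dA x.
      elim: P => [|P IH].
        rewrite addn0 Fq; last by move=> n; exact: p1.
        by rewrite !subrr normr0 mulr0 mul0r.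
      rewrite addnS FS addrAC (le_trans (ler_normD _ _))//.
      rewrite (le_trans (lerD IH (wsmall _ _ dx)))// -mulrDl ler_wpM2r ?(ltW dx)//.
      by have := epsS (m + P); lra.
    have [qa _ _] := hq m; rewrite -(qa a Aa).
    have := qlip m m a x a Aa (leqnn m) (lt_trans xa _) aa => /(_ _)h2.
    have {}h2 : `|q m x - q m a - G a (x - a)| <= eps m * `|x - a|.
      by apply: h2; lra.
    have -> : F (m + M)%N x - q m a - G a (x - a) =
      (F (m + M)%N x - q m x) + (q m x - q m a - G a (x - a)).
      by rewrite !addrA subrK.
    rewrite (le_trans (ler_normD _ _))// (le_trans (lerD (FqM M) h2))//.
    have := dAle x a Aa; have := eps0 (m + M); have := eps0 m; nra.
  pose d := Num.min (rho m a / 3 - `|x - a|) (dA x).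
  have d0 : 0 < d by rewrite lt_min dx andbT subr_gt0.
  have := @ft_lip m x (G a) (eps m) d d0 dx => /(_ _)[].
    have near_a y : `|y - x| < d -> 0 < dA y /\ `|y - a| < rho m a / 3.
      rewrite lt_min => /andP[y1 y2]; split; last by have := ler_distD x y a; lra.
      by have := dAD y x; rewrite ler_norml => /andP[]; lra.
    move=> y z /near_a[dy ya] /near_a[dz za].
    rewrite !Fq; [|by move=> n; exact: p1|by move=> n; exact: p1].
    by apply: (qlip m m a) => //; lra.
  move=> d1 d10 h1; exists d1 => // y z yd zd; rewrite (le_trans (h1 y z yd zd))//.
  by rewrite ler_wpM2r//; lra.
move=> x Ox nAx; have dx := Opos x Ox nAx.
have [_ _ /(_ x Ox)[K [d d0 hd]]] := hq 0%N.
exists (K + 28 * eps 0); apply: (ft_lip 0%N x 0 K d) => // y z yd zd.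
by rewrite !Fq; [exact: hd| |]; case.
Qed.

End StrictExtension.

(** * Smooth approximation with control of the derivative *)

Section SmoothApproximation.
Context {R : realType}.
Variables (X Y : normedModType R).

Lemma lip_near_fder (g : X -> Y) x (D T : clin X Y) (e : R) : 0 <= e ->
  fder g x D -> lip_near g x T e -> `|D - T| <= e.
Proof.
move=> e0 gD [d d0 gT]; apply/ler_addgt0Pr => eta eta0.
have [d' d'0 gD'] := gD eta eta0.
apply: (@clin_norm_near0 _ _ _ _ _ (Num.min d d')).
- by rewrite addr_ge0// ltW.
- by rewrite lt_min d0.
move=> h; rewrite lt_min => /andP[hd hd'].
have hx : x + h - x = h by rewrite addrC addKr.
have := gT (x + h) x; have := gD' (x + h).
rewrite hx subrr normr0 => /(_ hd') h1 /(_ hd d0) h2.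
have -> : (D - T) h = g (x + h) - g x - T h - (g (x + h) - g x - D h).
  by rewrite (opprB _ (D h)) [RHS]addrC addrA subrK.
by rewrite (le_trans (ler_normB _ _))// mulrDl lerD.
Qed.

(** Both operators approximate the same increments of [g]. This ties an operator chosen at [x]
    without reference to [A] to the value of [G] at a nearby point of [A]. *)
Lemma lip_near_dist (g : X -> Y) x (T T' : clin X Y) (e e' : R) :
  0 <= e -> 0 <= e' ->
  lip_near g x T e -> lip_near g x T' e' -> `|T - T'| <= e + e'.
Proof.
move=> e0 e'0 [d d0 gT] [d' d'0 gT'].
apply: (@clin_norm_near0 _ _ _ _ _ (Num.min d d')).
- exact: addr_ge0.
- by rewrite lt_min d0.
move=> h; rewrite lt_min => /andP[hd hd'].
have hx : x + h - x = h by rewrite addrC addKr.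
have := gT (x + h) x; have := gT' (x + h) x.
rewrite hx subrr normr0 => /(_ hd' d'0) h1 /(_ hd d0) h2.
have -> : (T - T') h = g (x + h) - g x - T' h - (g (x + h) - g x - T h).
  by rewrite (opprB _ (T h)) [RHS]addrC addrA subrK.
by rewrite (le_trans (ler_normB _ _))// mulrDl addrC lerD.
Qed.

Lemma Ck_on_C1 (O : set X) k (g : X -> Y) : open O -> k <> Some 0%N ->
  Ck_on O k g -> Cn_on O 1 g.
Proof.
move=> oO; case: k => [[//|n] _|_]; last exact.
elim: n => [//|n IH] h; apply: IH.
exact: (@Cn_onW _ _ _ O n.+1 g oO h).
Qed.

Lemma sum_half_pow N : \sum_(i < N) (2^-1 : R) ^+ i.+1 <= 1.
Proof.
suff -> : \sum_(i < N) (2^-1 : R) ^+ i.+1 = 1 - 2^-1 ^+ N.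
  by rewrite gerBl exprn_ge0// invr_ge0.
elim: N => [|N IH]; first by rewrite big_ord0 expr0 subrr.
by rewrite big_ord_recr/= IH exprS; field.
Qed.

Variables (k : option nat) (y0 : Y).
Hypotheses (hk : k <> Some 0%N).
Hypotheses (y0N0 : y0 != 0) (hLE : propLE X Y) (hLA : propLA k X Y).

(** Smoothing [ft - T a] on the cell of [a] makes the constant [C] of (LA_k) multiply only [L a].
    The reference operator [T0] is left free in order to be a value of [G] later. *)
Lemma smooth_approx : exists2 C : R, 0 <= C &
  forall (O : set X) (ft : X -> Y) (T : X -> clin X Y) (L r e : X -> R),
    open O ->
    (forall x, O x -> [/\ 0 < r x, 0 <= L x, 0 < e x &
       forall y z, ball x (r x) y -> ball x (r x) z ->
         `|ft y - ft z - T x (y - z)| <= L x * `|y - z|]) ->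
  exists g : X -> Y, Ck_on O k g /\
    forall x (T0 : clin X Y) (c1 c2 : R), O x -> 0 <= c1 -> 0 <= c2 ->
      (forall a, O a -> ball a (r a) x ->
         `|T a - T0| + C * L a <= c1 /\ e a <= c2) ->
      `|g x - ft x| <= c2 /\ `|fderiv g x - T0| <= c1 + c2.
Proof.
have [C C0 LA] := propLA_ball hLA; exists C => // O ft T L r e oO hO.
have r0 x : O x -> 0 < r x by move=> /hO[].
have [phi [K [phiC phi0 K0 phiK glue]]] := smooth_gluing y0N0 hLE hLA r0.
(* The weights make the sum of [K i] times the errors at most a geometric series of sum at most [1]
   times the bound on [e], however large the constants [K i] are. *)
pose al n a := e a * (2^-1 ^+ n.+1 / (K n + 1)).
have half0 n : 0 < (2^-1 : R) ^+ n.+1 by rewrite exprn_gt0// invr_gt0.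
have K10 n : 0 < K n + 1 by rewrite ltr_wpDl.
have fac0 n : 0 < 2^-1 ^+ n.+1 / (K n + 1) by rewrite divr_gt0.
have fac1 n : 2^-1 ^+ n.+1 / (K n + 1) <= 1.
  rewrite ler_pdivrMr// mul1r (@le_trans _ _ 1) ?lerDr//.
  by rewrite exprn_ile1// ?invr_ge0// invf_le1 ?ler1n.
have /choice[h hh] : forall na : nat * X, exists h : X -> Y, O na.2 ->
    let: (n, a) := na in
    [/\ forall y z, ball a (r a) y -> ball a (r a) z ->
          `|h y - h z - T a (y - z)| <= C * L a * `|y - z|,
        Ck_on (ball a (r a)) k h &
        forall y, ball a (r a) y -> `|h y - ft y| <= al n a].
  move=> [n a]; have [Oa|nO] := pselect (O a); last by exists (cst 0).
  have [ra La ea hft] := hO a Oa.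
  have al0 : 0 < al n a by rewrite mulr_gt0.
  have [|p [pL Cp pf]] := LA a (r a) (L a) (al n a) (fun y => ft y - T a y) ra La al0.
    move=> y z By Bz.
    have -> : ft y - T a y - (ft z - T a z) = ft y - ft z - T a (y - z).
      rewrite clinB !opprB [LHS]addrACA [RHS]addrACA; congr (_ + _).
      exact: addrC.
    exact: hft.
  exists (fun y => p y + T a y) => _; split.
  - move=> y z By Bz; rewrite clinB opprD (addrACA (p y)) addrK; exact: pL.
  - apply/Ck_onP => m km; have oB : open (ball a (r a)) by exact: ball_open.
    apply: Cn_onD => //; first exact: (Ck_onP _ _ _).1 Cp m km.
    exact: Cn_on_clin.
  move=> y By; rewrite distrC; have := pf y By.
  by rewrite opprD addrA addrAC.
pose hn n a := h (n, a).
have {}hh n a : O a ->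
    [/\ forall y z, ball a (r a) y -> ball a (r a) z ->
          `|hn n a y - hn n a z - T a (y - z)| <= C * L a * `|y - z|,
        Ck_on (ball a (r a)) k (hn n a) &
        forall y, ball a (r a) y -> `|hn n a y - ft y| <= al n a].
  exact: hh (n, a).
have [g hg] := glue hn.
exists g; have Cg : Ck_on O k g.
  apply/Ck_onP => m km; apply: Cn_on_local => // x Ox.
  have [N [a [d d0 [hd ha]]]] := hg x Ox.
  exists (ball x d), (fun y => \sum_(i < N) phi i y *: hn i (a i) y).
  have oB : open (ball x d) by exact: ball_open.
  split=> //; first exact: ballxx.
    apply: (@Cn_on_sum _ _ _ _ _ (fun i y => phi i y *: hn i (a i) y)) => // i iN.
    have [p0|[Oa hai]] := ha i iN.
      apply: Cn_on_ext (Cn_on_cst m 0 oB) => //.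
      by move=> y; rewrite ball_distE => /p0 ->; rewrite scale0r.
    have [_ Ch _] := hh i _ Oa.
    apply: Cn_onZ => //.
      exact: Cn_on_sub (openT) oB _ (phiC i m km).
    apply: Cn_on_sub _ oB _ ((Ck_onP _ _ _).1 Ch m km); first exact: ball_open.
    by move=> y; rewrite ball_distE; exact: hai.
  by move=> y; rewrite ball_distE => /hd[].
split=> // x T0 c1 c2 Ox c10 c20 hc.
have [N [a [d d0 [hd ha]]]] := hg x Ox.
have xx : `|x - x| < d by rewrite subrr normr0.
pose D i := c2 * (2^-1 ^+ i.+1 / (K i + 1)).
have D0 i : 0 <= D i by rewrite mulr_ge0// ltW.
have Dc i : D i <= c2 by rewrite ler_piMr.
have cell i : (i < N)%N -> (forall y, `|y - x| < d -> phi i y = 0) \/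
    forall y z, `|y - x| < d -> `|z - x| < d ->
      `|hn i (a i) y - hn i (a i) z - T0 (y - z)| <= c1 * `|y - z| /\
      `|hn i (a i) z - ft z| <= D i.
  move=> iN; have [p0|[Oa hai]] := ha i iN; [by left|right=> y z yd zd].
  have [hL _ hf] := hh i _ Oa; have [Tc ec] := hc _ Oa (hai x xx).
  split; last by rewrite (le_trans (hf z (hai z zd)))// ler_wpM2r// ltW.
  have -> : hn i (a i) y - hn i (a i) z - T0 (y - z) =
      hn i (a i) y - hn i (a i) z - T (a i) (y - z) + (T (a i) - T0) (y - z).
    by rewrite clinD addrA subrK.
  rewrite (le_trans (ler_normD _ _))//.
  rewrite (le_trans (lerD (hL _ _ (hai y yd) (hai z zd)) (clin_norm _ _)))//.
  by rewrite -mulrDl ler_wpM2r// addrC.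
split.
  have [-> s1] := hd x xx.
  rewrite -[ft x]scale1r -s1 scaler_suml -sumrB (le_trans (ler_norm_sum _ _ _))//.
  rewrite -[leRHS]mul1r -s1 mulr_suml; apply: ler_sum => i _.
  rewrite -scalerBr normrZ ger0_norm//.
  have [p0|hi] := cell i (ltn_ord i); first by rewrite p0// !mul0r.
  by rewrite ler_wpM2l//; have [_ /le_trans] := hi x x xx xx; apply.
have fd : fder g x (fderiv g x).
  by apply: fderivP; have [dg _] := Ck_on_C1 oO hk Cg; exact: dg.
apply: lip_near_fder fd _; first exact: addr_ge0.
exists d => // y z yd zd; have [-> sy] := hd y yd; have [-> sz] := hd z zd.
have := @gluing_estimate _ _ _ N phi (fun i => hn i (a i)) K D T0 (ft z) c1 y z
  (fun i => phi0 i y) c10 K0 D0 (fun i => phiK i y z) sy sz.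
move=> /(_ _)/le_trans; apply.
  move=> i iN; have [p0|hi] := cell i iN; first by left; rewrite !p0.
  by right; exact: hi.
rewrite ler_wpM2r// lerD2l (@le_trans _ _ (\sum_(i < N) c2 * 2^-1 ^+ i.+1))//.
  apply: ler_sum => i _; rewrite mulrCA ler_wpM2l// mulrCA ler_piMr ?(ltW (half0 i))//.
  by rewrite ler_pdivrMr// mul1r lerDl.
by rewrite -mulr_sumr ler_piMr// sum_half_pow.
Qed.

End SmoothApproximation.

(** * Smoothing off [A] and differentiability across [A] *)

Theorem theorem39 (R : realType) (X : normedModType R)
    (Y : completeNormedModType R) (k : option nat) (hk : k <> Some 0%N)
    (hLE : propLE X Y) (hLA : propLA k X Y)
    (Omega : set X) (hOmega : open Omega)
    (A : set X) (hA : A `<=` Omega)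
    (hAcl : exists2 F : set X, closed F & A = Omega `&` F)
    (f : X -> Y) (G : X -> clin X Y) (hW : condW A f G) :
  exists g : X -> Y,
    [/\ {in A, g =1 f},
        Ck_on Omega (Some 1%N) g,
        {in A, fderiv g =1 G} &
        Ck_on (Omega `\` A) k g].
Proof.
have oO : open (Omega `\` A).
  have [F Fcl AE] := hAcl; have -> : Omega `\` A = Omega `&` ~` F.
    apply/seteqP; split=> x [Ox nx]; split=> //.
      by move=> Fx; apply: nx; rewrite AE.
    by rewrite AE => -[].
  by apply: openI => //; exact: closed_openC.
(* The bump functions need a nonzero vector of [Y]; without one, all maps into [Y] coincide. *)
have [[y0 y0N0]|Y0] := pselect (exists y0 : Y, y0 != 0); last first.
  have {}Y0 (y z : Y) : y = z.
    have z0 (u : Y) : u = 0 by apply/eqP/negPn/negP => u0; apply: Y0; exists u.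
    by rewrite (z0 y) (z0 z).
  exists (cst 0); split.
  - by move=> x _; exact: Y0.
  - exact: Cn_on_cst.
  - by move=> x _; apply: clinP => u; exact: Y0.
  by apply/Ck_onP => n _; exact: Cn_on_cst.
have [ft [ftA ftG ftO]] := strict_extension y0N0 hLE hLA hA hAcl hW.
pose O := Omega `\` A.
have /choice[del hdel] : forall x, exists d : R, O x ->
    0 < d /\ forall a, A a -> d <= `|a - x|.
  move=> x; have [[Ox nAx]|nOx] := pselect (O x); last by exists 0 => /nOx.
  by have [d d0 hd] := relatively_closed_dist hAcl Ox nAx; exists d.
have /choice[TL hTL] : forall x, exists TL : clin X Y * R, O x ->
    [/\ 0 <= TL.2, lip_near ft x TL.1 TL.2 &
      forall T L, 0 <= L -> lip_near ft x T L -> TL.2 <= L + del x].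
  move=> x; have [Ox|nOx] := pselect (O x); last by exists (0, 0) => /nOx.
  have [del0 _] := hdel x Ox.
  pose S := [set L | 0 <= L /\ exists T, lip_near ft x T L].
  have S0 : S !=set0.
    have [K [d d0 hd]] := ftO x Ox.1 Ox.2; exists `|K|; split=> //.
    exists 0, d => // y z yd zd; rewrite (le_trans (hd y z yd zd))//.
    by rewrite ler_wpM2r// ler_norm.
  have Slb : has_lbound S by exists 0 => L [].
  (* The infimum of the admissible constants need not be attained; the tolerance [del x] is harmless
     because it is at most the distance from [x] to any point of [A]. *)
  have [L [L0 [T TL]] Linf] := inf_adherent del0 (conj S0 Slb).
  exists (T, L) => _; split=> //= T' L' L'0 T'L'.
  by rewrite (le_trans (ltW Linf))// lerD2r ge_inf//; split=> //; exists T'.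
pose T x := (TL x).1; pose L x := (TL x).2.
(* Cells of radius at most [del x / 2] shrink towards [A]: if the cell of [b] contains [x], then [b]
   is at most twice as far from any [a] in [A] as [x] is. *)
have /choice[r hr] : forall x, exists r : R, O x ->
    [/\ 0 < r, r <= del x / 2 & forall y z, ball x r y -> ball x r z ->
      `|ft y - ft z - T x (y - z)| <= L x * `|y - z|].
  move=> x; have [Ox|nOx] := pselect (O x); last by exists 0 => /nOx.
  have [del0 _] := hdel x Ox; have [_ [d d0 hd] _] := hTL x Ox.
  exists (Num.min d (del x / 2)) => _; split.
  - by rewrite lt_min d0 divr_gt0.
  - by rewrite ge_min lexx orbT.
  by move=> y z; rewrite !ball_distE !lt_min => /andP[yd _] /andP[zd _]; exact: hd.
have [C C0 SA] := smooth_approx hk y0N0 hLE hLA.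
(* A quadratic error makes [g - ft] negligible against the distance to [a], and makes its
   contribution to the derivative tend to [0]. *)
have [|g [Cg hg]] := SA O ft T L r (fun x => del x ^+ 2) oO.
  move=> x Ox; have [r0 _ hft] := hr x Ox; have [L0 _ _] := hTL x Ox.
  by have [del0 _] := hdel x Ox; split=> //; rewrite exprn_gt0.
have key a (e : R) : A a -> 0 < e -> exists2 d : R, 0 < d &
    forall x, O x -> `|x - a| < d ->
      `|g x - f a - G a (x - a)| <= e * `|x - a| /\ `|fderiv g x - G a| <= e.
  move=> Aa e0.
  have C20 : 0 < C + 2 by rewrite ltr_wpDl.
  (* On a relevant cell [L b <= 2 * e1], the operator [T b] is within [3 * e1] of [G a], and
     [3 * e1 + C * (2 * e1)] is at most [(C + 2) * (2 * e1) = e / 2]. *)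
  pose e1 := e / (4 * (C + 2)).
  have e10 : 0 < e1 by rewrite divr_gt0// mulr_gt0.
  have [d1 d10 hd1] := ftG a e1 Aa e10.
  (* The halves allow for centres [b] twice as far from [a] as [x]. The bounds [e / 16] and [1] give
     [4 * |x - a| ^+ 2 <= e / 4 * |x - a|] and [4 * |x - a| ^+ 2 <= e / 4]. *)
  exists (Num.min (Num.min (d1 / 2) (e1 / 2)) (Num.min (e / 16) 1)).
    rewrite !lt_min; have [-> -> ->] : [/\ 0 < d1 / 2, 0 < e1 / 2 & 0 < e / 16].
      by split; rewrite divr_gt0.
    by rewrite /= ltr01.
  move=> x Ox; rewrite !lt_min => /andP[/andP[xd1 xe1] /andP[xe x1]].
  have n0 : 0 <= `|x - a| by [].
  have e1E : (C + 2) * (2 * e1) = e / 2.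
    by rewrite /e1; field; rewrite gt_eqF.
  have [] := hg x (G a) (e / 2) (4 * `|x - a| ^+ 2) Ox.
  - by rewrite divr_ge0// ltW.
  - by rewrite mulr_ge0// exprn_ge0.
  - move=> b Ob; rewrite ball_distE => xb.
    have [rb0 rb _] := hr b Ob; have [delb hdelb] := hdel b Ob.
    have ab := hdelb a Aa.
    have ba : `|b - a| <= 2 * `|x - a|.
      by rewrite distrC in ab; have := ler_distD x b a; rewrite (distrC b x); lra.
    have [|_ lipb] := hd1 b Ob.1 Ob.2; first by lra.
    have [Lb0 TLb Lmin] := hTL b Ob.
    have Lb := Lmin _ _ (ltW e10) lipb.
    have Tb := lip_near_dist Lb0 (ltW e10) TLb lipb.
    rewrite distrC in ab; split; last first.
      rewrite (_ : 4 * _ = (2 * `|x - a|) ^+ 2); last by ring.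
      by rewrite lerXn2r ?nnegrE ?mulr_ge0//; lra.
    rewrite -/(L b) in Lb Tb Lb0 *; rewrite -/(T b) in Tb.
    have Lb2 : L b <= 2 * e1 by lra.
    have : C * L b <= C * (2 * e1) by rewrite ler_wpM2l.
    by rewrite -e1E; lra.
  have xd1' : `|x - a| < d1 by lra.
  have [h1 _] := hd1 x Ox.1 Ox.2 xd1'; move=> h2 h3.
  have sq : `|x - a| ^+ 2 <= e / 16 * `|x - a| by rewrite expr2 ler_wpM2r// ltW.
  have sq' : `|x - a| ^+ 2 <= e / 16.
    by rewrite (le_trans sq)// ler_piMr ?ltW// divr_gt0.
  split; last by rewrite (le_trans h3)//; lra.
  have -> : g x - f a - G a (x - a) = (g x - ft x) + (ft x - f a - G a (x - a)).
    by rewrite !addrA subrK.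
  rewrite (le_trans (ler_normD _ _))// (le_trans (lerD h2 h1))//.
  have : e1 * `|x - a| <= e / 2 * `|x - a|.
    rewrite ler_wpM2r// -e1E; have := mulr_ge0 C0 (ltW e10); lra.
  by have := mulr_ge0 (ltW e0) n0; lra.
(* The gluing determines [g] only off [A], so the values on [A] are put in by hand; [key] and (W)
   join the two parts. *)
pose g' x := if x \in A then f x else g x.
have g'A x : A x -> g' x = f x by move=> Ax; rewrite /g' mem_set.
have g'O x : O x -> g' x = g x by move=> [_ nAx]; rewrite /g' memNset.
have Cg' : Ck_on O k g'.
  apply/Ck_onP => n kn; apply: Cn_on_ext ((Ck_onP _ _ _).1 Cg n kn) => //.
  by move=> x /g'O.
have C1g' := Ck_on_C1 oO hk Cg'.
have g'D x : O x -> fderiv g' x = fderiv g x.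
  move=> Ox; have [dg _] := Ck_on_C1 oO hk Cg.
  apply: fder_eq; apply: (fder_near _ (fderivP (dg x Ox))).
  have : nbhs x O by exact: open_nbhs_nbhs.
  by apply: filterS => y /g'O.
have fdA a : A a -> fder g' a (G a).
  move=> Aa e e0; have [_ /(_ a Aa e e0)[d1 d10 h1]] := hW.
  have [d2 d20 h2] := key a e Aa e0.
  have /nbhs_distP[d3 d30 h3] : nbhs a Omega.
    by apply: open_nbhs_nbhs; split=> //; exact: hA.
  exists (Num.min d1 (Num.min d2 d3)); first by rewrite !lt_min d10 d20.
  move=> y; rewrite !lt_min => /and3P[y1 y2 y3]; rewrite (g'A a Aa).
  have [Ay|nAy] := pselect (A y).
    rewrite g'A//; apply: h1; split=> //; first exact: ballxx.
    by rewrite ball_distE.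
  have Oy : O y by split=> //; exact: h3.
  by rewrite g'O//; have [] := h2 y Oy y2.
have fderivA a : A a -> fderiv g' a = G a by move=> /fdA/fder_eq.
exists g'; split.
- by move=> x; rewrite inE => /g'A.
- split=> [x Ox|].
    have [Ax|nAx] := pselect (A x); first by have /fderP[] := fdA x Ax.
    by have [dg _] := C1g'; exact: dg.
  apply/Cn_on0P => // x Ox; have [Ax|nAx] := pselect (A x); last first.
    by have [_ /Cn_on0P h] := C1g'; exact: h.
  apply/continuous_distP => e e0; rewrite fderivA//.
  have [d1 d10 h1] := condW_continuous hW Ax e0.
  have [d2 d20 h2] := key x e Ax e0.
  have /nbhs_distP[d3 d30 h3] : nbhs x Omega by exact: open_nbhs_nbhs.
  exists (Num.min d1 (Num.min d2 d3)); first by rewrite !lt_min d10 d20.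
  move=> y; rewrite !lt_min => /and3P[y1 y2 y3].
  have [Ay|nAy] := pselect (A y); first by rewrite fderivA//; exact: h1.
  have Oy : O y by split=> //; exact: h3.
  by rewrite g'D//; have [] := h2 y Oy y2.
- by move=> x; rewrite inE => /fderivA.
exact: Cg'.
Qed.
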